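(* Fix integers $l_1,l_2\geq 0$ and reals $\epsilon_1,\epsilon_2>0$. There exists $M(\epsilon_1,\epsilon_2)>0$ such that for all $g>M(\epsilon_1,\epsilon_2)$ and all pairs of subsets \[C,C'\subseteq \big[1,(\gamma-\epsilon_1)g\big) \cup \big((\gamma+\epsilon_1)g,(2\gamma-\epsilon_1)g\big) \cup \big((2\gamma+\epsilon_1)g,2g\big]\] (subsets of integers) with $|C|=l_1$, $|C'|=l_2$ and $C\cap C'=\emptyset$, we have \[\left|\mathbb{P}_g[C\subseteq S \text{ and } C'\cap S=\emptyset]-\prod_{n\in C}f_{1}\left(\frac{n}{g}\right)\prod_{n\in C'}\left(1-f_{1}\left(\frac{n}{g}\right)\right)\right|<\epsilon_2.\]
   Context: A numerical semigroup is a submonoid of $\mathbb{N}_0$ with finite complement; its genus is the size of the complement. $\mathcal{S}_g$ is the set of numerical semigroups of genus $g$ and $\mathbb{P}_g$ is the uniform probability on $\mathcal{S}_g$, $S$ denoting a random element. Let $\gamma=\frac{5+\sqrt5}{10}$ and define $f_1:[0,2]\setminus\{\gamma,2\gamma\}\to[0,1]$ by $f_1(x)=0$ if $0\le x<\gamma$, $f_1(x)=\frac{\sqrt5-1}{2}$ if $\gamma<x<2\gamma$, and $f_1(x)=1$ if $2\gamma<x\le 2$. *)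

(* Defs.v *)
From HB Require Import structures.
From mathcomp Require Import all_boot all_order all_algebra.
From mathcomp Require Import finmap.
From mathcomp Require Import all_classical all_reals.
Set Implicit Arguments. Unset Strict Implicit. Unset Printing Implicit Defensive.
Import Order.TTheory GRing.Theory Num.Theory.
Local Open Scope classical_set_scope.
Local Open Scope ring_scope.

Definition numerical_semigroup (S : set nat) : Prop :=
  S 0%N /\ (forall a b, S a -> S b -> S (a + b)%N) /\ finite_set (~` S).

Definition genus (S : set nat) : nat := #|` fset_set (~` S)|%fset.

Definition numsgps (g : nat) : set (set nat) :=
  [set S | numerical_semigroup S /\ genus S = g].

Definition Pg (R : realType) (g : nat) (E : set (set nat)) : R :=
  (#|` fset_set (numsgps g `&` E)|%fset)%:R / (#|` fset_set (numsgps g)|%fset)%:R.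

Definition gamma (R : realType) : R := (5 + Num.sqrt 5) / 10.

(** f_1 ; its values at the excluded points gamma, 2 gamma are irrelevant
    (set to 0 here; never used in the theorem). *)
Definition f1 (R : realType) (x : R) : R :=
  if x < gamma R then 0
  else if x == gamma R then 0
  else if x < 2 * gamma R then (Num.sqrt 5 - 1) / 2
  else if x == 2 * gamma R then 0
  else 1.

Definition admissible (R : realType) (g : nat) (eps1 : R) (n : nat) : Prop :=
  let x : R := n%:R in let G : R := g%:R in
  ((1 <= x) && (x < (gamma R - eps1) * G)) \/
  (((gamma R + eps1) * G < x) && (x < (2 * gamma R - eps1) * G)) \/
  (((2 * gamma R + eps1) * G < x) && (x <= 2 * G)).

(* Main.v *)
Require Import Defs.
From HB Require Import structures.
From mathcomp Require Import all_boot all_order all_algebra.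
From mathcomp Require Import finmap.
From mathcomp Require Import all_classical all_reals.
From mathcomp Require Import zify ring lra.
From mathcomp.analysis Require Import sequences exp.
Import Order.TTheory GRing.Theory Num.Theory.
Local Open Scope classical_set_scope.
Local Open Scope ring_scope.

(** A numerical semigroup of multiplicity [m] is encoded by its Kunz coordinates
    [k_1, ..., k_(m-1)]: [k_i] is the number of gaps congruent to [i] modulo [m],
    so the genus is their sum, and [k_i + k_j >= k_(i+j)] for [i + j < m],
    [k_i + k_j + 1 >= k_(i+j-m)] for [i + j > m]. Give a coordinate list the
    weight [x ^ genus] with [x = (sqrt 5 - 1) / 2]. Since [x + x^2 = 1] and every
    list over {1, 2} is admissible, the semigroups of genus [g] number at least
    [x^(1-g)]. All lists are then shown to be exponentially rarer than that unless
    [m] is close to [gamma * g], all coordinates are at most 3, and they are at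
    most 2 outside a short initial segment. For a maximal coordinate [q >= 3] at
    index [l] the mirror inequalities [k_i + k_j >= q] ([i + j = l]) and
    [k_i + k_j >= q - 1] ([i + j = l + m]) nearly suffice; the remaining factor
    comes from the least [a] with [k_a = 1], for which [k_(i+a) <= k_i + 1] and
    [k_i >= 2] when [i < a]. Given [m] and the initial segment, the rest of a
    typical list is a uniformly random list over {1, 2} with prescribed sum. Hence
    its entries behave like draws without replacement, and an integer [n] between
    [m] and [2 m] lies in the semigroup iff [k_(n-m) = 1], which has limiting
    probability [x]. *)

(** * Weighted sums over arcs *)

(** Two mirror coordinates in [1, p] with sum at least p have total weight, at [x], exactly 1 for p
    = 2, about 1.15 for p = 3, 1.06 for p = 4, 0.88 for p = 5, and stay below 1 afterwards. The
    mirror inequalities alone therefore fail on arcs with p = 3 or p = 4, and the index [a] of the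
    first 1 repairs this: if [a] is small, most positions have both a predecessor and a successor at
    distance [a]; if [a] is large, many coordinates avoid the cheap value 1. For q >= 4 the two arcs
    together have bounded weight even at 619/1000, and since [x] is smaller, passing to [x] gains
    exponentially in the genus. For q = 3 the right arc is a free list over {1, 2} of weight exactly
    1 per entry at [x], so such lists are not rare as such: only the left arc decays, which makes it
    short, and the multiplicity has to be controlled by varying the weight. All bounds are proved
    for fixed size, maximum, last place of the maximum and first place of 1; there are only
    polynomially many such keys. *)

Fixpoint lists (Q n : nat) : seq (seq nat) :=
  if n is n'.+1 then [seq rcons s v | s <- lists Q n', v <- iota 1 Q]
  else [:: [::]].

Lemma mem_lists Q n s :
  (s \in lists Q n) = (size s == n) && all (fun v => (0 < v <= Q)%N) s.
Proof.
elim: n s => [|n IHn] s /=; first by rewrite inE; case: s.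
apply/allpairsP/idP => [[[p v] /= [+ + ->]]|].
  rewrite IHn mem_iota size_rcons all_rcons => /andP[/eqP-> ->].
  by rewrite eqxx andbT add1n ltnS.
case/lastP: s => [//|p v]; rewrite size_rcons eqSS all_rcons => /and3P[sp hv ap].
by exists (p, v); rewrite IHn sp ap mem_iota add1n ltnS.
Qed.

Lemma uniq_lists Q n : uniq (lists Q n).
Proof.
elim: n => [//|n IHn] /=; apply: allpairs_uniq => //; first exact: iota_uniq.
by move=> [s v] [s' v'] _ _ /= /rcons_inj[-> ->].
Qed.

(** The entries are summed out from the last one backwards. As [V] passes to prefixes, an invalid
    prefix contributes nothing, and for a valid one the innermost sum is at most [c], whatever the
    prefix is. *)
Lemma sum_lists_le (R : realFieldType) (Q n : nat) (V : pred (seq nat))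
    (w : seq nat -> nat -> R) (c : nat -> R) :
  (forall s v, V (rcons s v) -> V s) ->
  (forall s v, 0 <= w s v) -> (forall t, 0 <= c t) ->
  (forall s, s \in lists Q (size s) -> (size s < n)%N -> V s ->
     \sum_(v <- iota 1 Q | V (rcons s v)) w s v <= c (size s)) ->
  \sum_(s <- lists Q n | V s) \prod_(t < n) w (take t s) (nth 0%N s t)
    <= \prod_(t < n) c t.
Proof.
move=> Vrcons w0 c0; elim: n => [|n IHn] wc.
  rewrite !big_ord0 big_mkcond big_seq1 big_ord0.
  by case: ifP => _; rewrite ?ler01.
rewrite big_ord_recr /= big_mkcond big_allpairs_dep /=.
apply: (@le_trans _ _ (\sum_(s <- lists Q n | V s)
   (\prod_(t < n) w (take t s) (nth 0%N s t)) * c n)); last first.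
  rewrite -mulr_suml ler_wpM2r// IHn// => s sQ sn Vs.
  by apply: wc => //; rewrite (ltn_trans sn).
rewrite [leRHS]big_mkcond big_seq [leRHS]big_seq; apply: ler_sum => s sQ.
rewrite -big_mkcond /=.
have szs : size s = n by move: sQ; rewrite mem_lists => /andP[/eqP].
case: ifPn => Vs; last first.
  by rewrite big1// => v /Vrcons; rewrite (negbTE Vs).
have -> : \sum_(v <- iota 1 Q | V (rcons s v))
    \prod_(t < n.+1) w (take t (rcons s v)) (nth 0%N (rcons s v) t) =
    (\prod_(t < n) w (take t s) (nth 0%N s t)) *
    \sum_(v <- iota 1 Q | V (rcons s v)) w s v.
  rewrite mulr_sumr; apply: eq_bigr => v _.
  rewrite big_ord_recr /= nth_rcons szs ltnn eqxx.
  rewrite -cats1 take_size_cat//; congr (_ * _).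
  apply: eq_bigr => t _; rewrite takel_cat ?szs 1?ltnW//.
  by rewrite nth_cat szs ltn_ord.
rewrite ler_wpM2l//; first by apply: prodr_ge0 => t _.
by rewrite -szs; apply: wc; rewrite ?szs.
Qed.

(* Let the largest Kunz coordinate [q] occur last at index [l]. The reflection
   [i |-> l - i] modulo [m] splits the remaining indices into two arcs,
   [0 < i < l] and [l < i < m], on which mirror coordinates sum to at least
   [p = q] and [p = q - 1], respectively. If [a] is the least index with coordinate 1 then adding [a] to
   an index raises the coordinate by at most 1, and the coordinates below [a]
   (the first [b] ones of the arc) exceed 1. An arc has [n] positions, counted
   from 0. *)
Definition arc_ok (p n a b : nat) (s : seq nat) : bool :=
  [&& all (fun t => (n.-1 - t < size s) ==>
                    (p <= nth 0 s t + nth 0 s (n.-1 - t)))%N (iota 0 (size s)),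
      all (fun t => (a <= t) ==> (nth 0 s t <= (nth 0 s (t - a)).+1))%N
          (iota 0 (size s))
    & all (fun t => (t < b) ==> (1 < nth 0 s t))%N (iota 0 (size s))].

Lemma arc_okP p n a b s :
  reflect [/\ forall t, (t < size s)%N -> (n.-1 - t < size s)%N ->
                (p <= nth 0 s t + nth 0 s (n.-1 - t))%N,
              forall t, (t < size s)%N -> (a <= t)%N ->
                (nth 0 s t <= (nth 0 s (t - a)).+1)%N
            & forall t, (t < size s)%N -> (t < b)%N -> (1 < nth 0 s t)%N]
          (arc_ok p n a b s).
Proof.
apply: (iffP and3P) => -[H1 H2 H3]; split.
- by move=> t ts; apply/implyP; apply: (allP H1); rewrite mem_iota.
- by move=> t ts; apply/implyP; apply: (allP H2); rewrite mem_iota.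
- by move=> t ts; apply/implyP; apply: (allP H3); rewrite mem_iota.
- by apply/allP => t; rewrite mem_iota => ts; apply/implyP; apply: H1.
- by apply/allP => t; rewrite mem_iota => ts; apply/implyP; apply: H2.
- by apply/allP => t; rewrite mem_iota => ts; apply/implyP; apply: H3.
Qed.

Lemma arc_ok_rcons p n a b s v : arc_ok p n a b (rcons s v) -> arc_ok p n a b s.
Proof.
move=> /arc_okP[]; rewrite size_rcons => H1 H2 H3; apply/arc_okP; split.
- move=> t ts ts'; have := H1 t (leqW ts) (leqW ts').
  by rewrite !nth_rcons ts ts'.
- move=> t ts at_; have := H2 t (leqW ts) at_.
  by rewrite !nth_rcons ts (leq_ltn_trans (leq_subr _ _) ts).
- by move=> t ts tb; have := H3 t (leqW ts) tb; rewrite nth_rcons ts.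
Qed.

Definition psum {R : realFieldType} (y : R) (p : nat) (P : pred nat)
    (f : nat -> R) : R :=
  \sum_(v <- iota 1 p | P v) y ^+ v * f v.

Lemma psum_le (R : realFieldType) (y : R) p (P Q : pred nat) (f : nat -> R) :
  0 <= y -> (forall v, 0 <= f v) -> (forall v, P v -> Q v) ->
  psum y p P f <= psum y p Q f.
Proof.
move=> y0 f0 PQ; rewrite /psum [leLHS]big_mkcond [leRHS]big_mkcond.
apply: ler_sum => v _; case: ifPn => [/PQ ->//|_]; case: ifP => // _.
by rewrite mulr_ge0// exprn_ge0.
Qed.

Section Arc.
Context {R : realFieldType}.
Variables (y : R) (p : nat) (u bM bS bN : nat -> R) (U K lam C : R).

(* The coordinates of an arc are summed out from left to right. A coordinate
   [v] carries the factor [u v] until its successor (the position [t + a]) is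
   reached and the factor [b v] until its mirror position is reached, where [b]
   is [bS] if exactly one of the two mirror positions has a successor, [bN] if
   none has, and [bM] if both have. A position then costs [lam] if it has both
   a predecessor and a successor, 1 if it only has a predecessor, and [K] or
   [U] if it has no predecessor, according to whether it is known to exceed 1.
   The self-mirror position, if any, costs an extra factor [C]. *)
Record potential : Prop := Potential {
  pot_y : 0 < y;
  pot_pos : forall v, [/\ 0 < u v, 0 < bM v, 0 < bS v & 0 < bN v];
  pot_cst : [/\ 0 < U, 0 < K & 0 < lam] /\ 0 < C;
  pot_M1 : forall c, (0 < c <= p)%N ->
    psum y p (fun v => v <= c.+1)%N (fun v => bM v * u v) <= lam * u c;
  pot_M2 : forall c d, (0 < c <= p)%N -> (0 < d <= p)%N ->
    psum y p (fun v => (v <= c.+1) && (p <= v + d))%N u <= lam * (bM d * u c);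
  pot_M0 : forall c, (0 < c <= p)%N ->
    psum y p (fun v => v <= c.+1)%N u <= C * lam * u c;
  pot_SU : psum y p xpredT (fun v => bS v * u v) <= U;
  pot_SK : psum y p (fun v => 1 < v)%N (fun v => bS v * u v) <= K;
  pot_F : forall c d, (0 < c <= p)%N -> (0 < d <= p)%N ->
    psum y p (fun v => (v <= c.+1) && (p <= v + d))%N (fun=> 1) <= bS d * u c;
  pot_N1U : psum y p xpredT bN <= U;
  pot_N1K : psum y p (fun v => 1 < v)%N bN <= K;
  pot_N2U : forall d, (0 < d <= p)%N ->
    psum y p (fun v => p <= v + d)%N (fun=> 1) <= U * bN d;
  pot_N2K : forall d, (1 < d <= p)%N ->
    psum y p (fun v => (1 < v) && (p <= v + d))%N (fun=> 1) <= K * bN d;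
  pot_N0U : psum y p xpredT (fun=> 1) <= C * U;
  pot_N0K : psum y p (fun v => 1 < v)%N (fun=> 1) <= C * K
}.
Hypothesis pot : potential.

Let bt n a t : nat -> R :=
  if (t < a)%N then if (t + a < n)%N then bS else bN
  else if (t + a < n)%N then bM else bS.

Let num n a t v : R :=
  (if (t.*2.+1 < n)%N then bt n a t v else 1) *
  (if (t + a < n)%N then u v else 1).

Let den n a t (s : seq nat) : R :=
  (if (n < t.*2.+1)%N then bt n a t (nth 0%N s (n.-1 - t)) else 1) *
  (if (a <= t)%N then u (nth 0%N s (t - a)) else 1).

Let bt_gt0 n a t v : 0 < bt n a t v.
Proof.
by rewrite /bt; have [_ ? ? ?] := pot_pos pot v; do !case: ifP => _.
Qed.

Let num_gt0 n a t v : 0 < num n a t v.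
Proof.
rewrite /num mulr_gt0//; case: ifP => // _; rewrite ?bt_gt0//.
by case: (pot_pos pot v).
Qed.

Let den_gt0 n a t s : 0 < den n a t s.
Proof.
rewrite /den mulr_gt0//; case: ifP => // _; rewrite ?bt_gt0//.
by case: (pot_pos pot (nth 0%N s (t - a))).
Qed.

(** The reindexing t -> n - 1 - t matches the mirror factors, because [bt] is invariant under it,
    and t -> t + a matches the successor factors. [den] reads earlier entries only, so [wt] can be
    summed entry by entry and still multiplies to y ^ sumn s. *)
Let telescope n a (s : seq nat) : (0 < a)%N ->
  \prod_(t < n) num n a t (nth 0%N s t) = \prod_(t < n) den n a t s.
Proof.
move=> a0; rewrite !big_split /=; congr (_ * _).
  rewrite (reindex_inj rev_ord_inj) /=; apply: eq_bigr => t _.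
  have tn := ltn_ord t.
  have -> : ((n - t.+1).*2.+1 < n)%N = (n < t.*2.+1)%N by lia.
  case: ifP => // nt; rewrite /bt.
  have -> : (n - t.+1 < a)%N = ~~ (t + a < n)%N by lia.
  have -> : (n - t.+1 + a < n)%N = ~~ (t < a)%N by lia.
  have -> : (n - t.+1 = n.-1 - t)%N by lia.
  by case: (t < a)%N; case: (t + a < n)%N.
have mk (P : pred nat) (F : nat -> R) :
    \prod_(t < n) (if P t then F t else 1) = \prod_(0 <= t < n | P t) F t.
  by rewrite [RHS]big_mkcond big_mkord.
rewrite (mk (fun t => t + a < n)%N (fun t => u (nth 0%N s t))).
rewrite (mk (fun t => a <= t)%N (fun t => u (nth 0%N s (t - a)))).
case: (leqP a n) => [an|na]; last first.
  rewrite big_nat_cond big1; last by move=> t; lia.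
  by rewrite big_nat_cond big1// => t; lia.
rewrite [RHS](big_cat_nat (n := a))//= [X in _ = X * _]big_nat_cond.
rewrite [X in _ = X * _]big1 ?mul1r; last by move=> t; lia.
have -> : \prod_(a <= t < n | (a <= t)%N) u (nth 0%N s (t - a)) =
          \prod_(0 <= t < n - a) u (nth 0%N s t).
  rewrite -[X in index_iota X _]add0n big_addn; apply: eq_big => t.
    by rewrite leq_addl.
  by rewrite addnK.
rewrite [LHS](big_cat_nat (n := n - a))//= ?leq_subr//.
rewrite [X in _ * X]big_nat_cond [X in _ * X]big1 ?mulr1; last by move=> t; lia.
rewrite big_nat_cond [RHS]big_nat_cond; apply: eq_bigl => t; lia.
Qed.

Let wt n a (s : seq nat) v : R := y ^+ v * num n a (size s) v / den n a (size s) s.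

Let prod_wt n a s : (0 < a)%N -> size s = n ->
  \prod_(t < n) wt n a (take t s) (nth 0%N s t) = y ^+ sumn s.
Proof.
move=> a0 szs.
have -> : \prod_(t < n) wt n a (take t s) (nth 0%N s t) =
   \prod_(t < n) (y ^+ nth 0%N s t * num n a t (nth 0%N s t) / den n a t s).
  apply: eq_bigr => t _; have tn := ltn_ord t.
  rewrite /wt size_takel ?szs 1?ltnW//; congr (_ / _).
  rewrite /den; congr (_ * _).
    by case: ifP => // nt; rewrite nth_take//; lia.
  by case: ifP => // at_; rewrite nth_take//; lia.
rewrite big_split /= big_split /= telescope// -mulrA -big_split /=.
rewrite [X in _ * X]big1 ?mulr1; last first.
  by move=> t _; rewrite divff// gt_eqF.
rewrite prodrXr; congr (_ ^+ _).
by rewrite sumnE (big_nth 0%N) szs big_mkord.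
Qed.

Let cl n a b t : R :=
  if (t < a)%N then (if (t < b)%N then K else U)
  else if (t + a < n)%N then lam else 1.

Let step_cst n a b t : R := cl n a b t * (if t.*2.+1 == n then C else 1).

Let psum_mono P Q f := psum_le R y p P Q f (ltW (pot_y pot)).

(** Each case is one field of [potential]. A position with a successor and no predecessor always
    precedes its mirror, one with a predecessor and no successor always follows it; in the other two
    situations all three orders occur. *)
Let step_le n a b s : (0 < a)%N -> (b <= a)%N ->
  s \in lists p (size s) -> (size s < n)%N -> arc_ok p n a b s ->
  \sum_(v <- iota 1 p | arc_ok p n a b (rcons s v)) wt n a s v
    <= step_cst n a b (size s).
Proof.
move=> a0 ba; rewrite mem_lists eqxx /= => /allP sp szn sok.
set t := size s in szn *.
have okv v : arc_ok p n a b (rcons s v) ->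
    [/\ (n < t.*2.+1)%N -> (p <= v + nth 0 s (n.-1 - t))%N,
        (a <= t)%N -> (v <= (nth 0 s (t - a)).+1)%N &
        (t < b)%N -> (1 < v)%N].
  move=> /arc_okP[]; rewrite size_rcons -/t => H1 H2 H3; split.
  - move=> nt; have := H1 t (ltnSn _).
    have nt' : (n.-1 - t < t)%N by lia.
    by rewrite !nth_rcons -/t ltnn eqxx nt' ltnS ltnW// => /(_ isT).
  - move=> at_; have := H2 t (ltnSn _) at_.
    have nt' : (t - a < t)%N by lia.
    by rewrite !nth_rcons -/t ltnn eqxx nt'.
  - by move=> tb; have := H3 t (ltnSn _) tb; rewrite nth_rcons -/t ltnn eqxx.
have sval i : (i < t)%N -> (0 < nth 0 s i <= p)%N.
  by move=> it; apply: sp; exact: mem_nth.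
have u0 v : 0 <= u v by apply/ltW; case: (pot_pos pot v).
have M0 v : 0 <= bM v by apply/ltW; case: (pot_pos pot v).
have S0 v : 0 <= bS v by apply/ltW; case: (pot_pos pot v).
have N0 v : 0 <= bN v by apply/ltW; case: (pot_pos pot v).
rewrite /wt -mulr_suml ler_pdivrMr ?den_gt0//.
rewrite -[X in X <= _]/(psum y p (fun v => arc_ok p n a b (rcons s v)) (num n a t)).
rewrite /num /den /step_cst /cl /bt -/t.
case: (ltnP t a) => ta; case: (ltnP (t + a) n) => tn.
- have -> : (t.*2.+1 < n)%N by lia.
  have -> : (n < t.*2.+1)%N = false by lia.
  have -> : t.*2.+1 == n = false by lia.
  rewrite !mulr1; case: ifP => tb.
    apply: le_trans (pot_SK pot); apply: psum_mono => [v|v /okv[_ _]]; last exact.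
    by rewrite mulr_ge0.
  by apply: le_trans (pot_SU pot); apply: psum_mono => // v; rewrite mulr_ge0.
- rewrite mulr1; case: (ltngtP t.*2.+1 n) => tn2.
  + rewrite !mulr1.
    have eb : (fun v => bN v * 1) = bN by apply/funext => v; rewrite mulr1.
    rewrite eb; case: ifP => tb.
      apply: le_trans (pot_N1K pot).
      by apply: psum_mono => // v /okv[_ _]; exact.
    by apply: le_trans (pot_N1U pot); apply: psum_mono.
  + have hs : (n.-1 - t < t)%N by lia.
    have eb : (fun v : nat => 1 * 1) = (fun=> 1 : R) by apply/funext => v; rewrite mulr1.
    rewrite eb !mulr1; case: ifP => tb.
      have h1 : (1 < nth 0 s (n.-1 - t))%N.
        by have /arc_okP[_ _] := sok; apply => //; lia.
      apply: le_trans (pot_N2K pot (nth 0 s (n.-1 - t))%N _); last first.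
        by have := sval _ hs; lia.
      apply: psum_mono => // v /okv[H _ H'].
      by rewrite H// H'.
    apply: le_trans (pot_N2U pot (nth 0 s (n.-1 - t))%N (sval _ hs)).
    by apply: psum_mono => // v /okv[H _ _]; exact: H.
  + have eb : (fun v : nat => 1 * 1) = (fun=> 1 : R) by apply/funext => v; rewrite mulr1.
    rewrite eb !mulr1; case: ifP => tb; rewrite mulrC.
      apply: le_trans (pot_N0K pot).
      by apply: psum_mono => // v /okv[_ _]; exact.
    by apply: le_trans (pot_N0U pot); apply: psum_mono.
- have hs : (t - a < t)%N by lia.
  have sc := sval _ hs.
  case: (ltngtP t.*2.+1 n) => tn2.
  + rewrite mulr1 mul1r; apply: le_trans (pot_M1 pot _ sc).
    by apply: psum_mono => [v|v /okv[_ H _]]; [rewrite mulr_ge0|exact: H].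
  + have hs' : (n.-1 - t < t)%N by lia.
    have eb : (fun v : nat => 1 * u v) = u by apply/funext => v; rewrite mul1r.
    rewrite eb mulr1; apply: le_trans (pot_M2 pot _ _ sc (sval _ hs')).
    by apply: psum_mono => // v /okv[H H' _]; rewrite H// H'.
  + have eb : (fun v : nat => 1 * u v) = u by apply/funext => v; rewrite mul1r.
    rewrite eb mul1r [lam * C]mulrC; apply: le_trans (pot_M0 pot _ sc).
    by apply: psum_mono => // v /okv[_ H _]; exact: H.
- have hs : (t - a < t)%N by lia.
  have hs' : (n.-1 - t < t)%N by lia.
  have -> : (t.*2.+1 < n)%N = false by lia.
  have -> : (n < t.*2.+1)%N by lia.
  have -> : t.*2.+1 == n = false by lia.
  have eb : (fun v : nat => 1 * 1) = (fun=> 1 : R) by apply/funext => v; rewrite mulr1.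
  rewrite eb !mul1r.
  apply: le_trans (pot_F pot _ _ (sval _ hs) (sval _ hs')).
  by apply: psum_mono => // v /okv[H H' _]; rewrite H'// H//; lia.
Qed.

Let prod_itv (x : R) lo hi n :
  \prod_(t < n) (if (lo <= t < hi)%N then x else 1) = x ^+ (minn hi n - lo).
Proof.
elim: n => [|n IHn]; first by rewrite big_ord0 minn0 sub0n expr0.
rewrite big_ord_recr /= IHn; case: ifP => h.
  by rewrite -exprSr; congr (_ ^+ _); lia.
by rewrite mulr1; congr (_ ^+ _); lia.
Qed.

Lemma arc_sum_le n a b : (0 < a)%N -> (b <= a)%N ->
  \sum_(s <- lists p n | arc_ok p n a b s) y ^+ sumn s <=
  (1 + C) * (K ^+ minn b n * U ^+ (minn a n - minn b n) * lam ^+ (n - a.*2)).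
Proof.
move=> a0 ba; have [[U0 K0 l0] C0] := pot_cst pot.
apply: (@le_trans _ _ (\prod_(t < n) step_cst n a b t)).
  rewrite big_seq_cond (eq_bigr (fun s => \prod_(t < n)
      wt n a (take t s) (nth 0%N s t))); last first.
    move=> s; rewrite mem_lists => /andP[/andP[/eqP sn _] _].
    by rewrite prod_wt.
  rewrite -big_seq_cond; apply: sum_lists_le.
  - by move=> s v; exact: arc_ok_rcons.
  - move=> s v; rewrite /wt mulr_ge0 ?invr_ge0 ?(ltW (den_gt0 _ _ _ _))//.
    rewrite mulr_ge0 ?(ltW (num_gt0 _ _ _ _))//.
    by rewrite exprn_ge0// ltW// (pot_y pot).
  - move=> t; rewrite /step_cst /cl mulr_ge0//; last by case: ifP => _ //; rewrite ltW.
    by do !case: ifP => _ //; rewrite ltW.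
  - by move=> s sl sn sok; exact: step_le.
rewrite big_split /= mulrC ler_pM//.
- by apply: prodr_ge0 => t _; case: ifP => // _; rewrite ltW.
- by apply: prodr_ge0 => t _; rewrite /cl; do !case: ifP => _ //; rewrite ltW.
(* At most one position is its own mirror, so this product is [C] or 1. *)
- have [/existsP[i /eqP iself]|noself] := boolP [exists i : 'I_n, i.*2.+1 == n].
    rewrite (bigD1 i)//= iself eqxx big1 ?mulr1; last first.
      move=> j ji; case: eqP => // jself; case/eqP: ji; apply: val_inj => /=.
      lia.
    by rewrite lerDr.
  rewrite big1 ?lerDl 1?ltW// => i _; case: eqP => // iself.
  by case/existsP: noself; exists i; rewrite iself.
- rewrite le_eqVlt; apply/orP; left; apply/eqP.
  have -> : minn b n = (minn b n - 0)%N by lia.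
  have -> : (minn a n - (minn b n - 0) = minn a n - b)%N by lia.
  have -> : (n - a.*2 = minn (n - a) n - a)%N by lia.
  rewrite -!prod_itv -!big_split /=; apply: eq_bigr => t _.
  have tn := ltn_ord t; rewrite /cl.
  case: (ltnP t a) => ta.
    have -> : (t < b)%N = ~~ (b <= t)%N by lia.
    by case: (b <= t)%N; rewrite /= ?ta ?mulr1 ?mul1r.
  have -> : (t < b)%N = false by lia.
  have -> : (t < n - a)%N = (t + a < n)%N by lia.
  by rewrite andbF /=; case: ifP; rewrite !mul1r.
Qed.
End Arc.

(** * Explicit potentials for each p *)

Definition tbl {R : realFieldType} (s : seq R) (v : nat) : R := nth 1 (0 :: s) v.-1.+1.

Lemma tbl_gt0 {R : realFieldType} (s : seq R) v : all (fun x => 0 < x) s -> 0 < tbl s v.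
Proof.
rewrite /tbl /=; elim: s v.-1 => [|x s IHs] [|n] //=; [by case/andP|].
by case/andP => _; exact: IHs.
Qed.

(* The weight 619/1000 is slightly larger than the inverse of the golden ratio.
   The tables were found by numerical optimization. *)
Lemma potential3 (R : realFieldType) : @potential R (619/1000) 3
  (tbl [:: 78/100; 1; 1]) (tbl [:: 623/1000; 1114/1000; 1114/1000])
  (tbl [:: 621/1000; 1285/1000; 1285/1000]) (tbl [:: 564/1000; 1127/1000; 1127/1000])
  (11/10) (8/10) (997/1000) 3.
Proof.
split.
- lra.
- by move=> v; split; apply: tbl_gt0 => /=; rewrite !andbT; do ?[apply/andP; split]; lra.
- split; [split|]; lra.
- by move=> [|[|[|[|c]]]]// _; rewrite /psum !big_cons big_nil /tbl /=; lra.
- by move=> [|[|[|[|c]]]]// [|[|[|[|d]]]]// _ _;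
    rewrite /psum !big_cons big_nil /tbl /=; lra.
- by move=> [|[|[|[|c]]]]// _; rewrite /psum !big_cons big_nil /tbl /=; lra.
- by rewrite /psum !big_cons big_nil /tbl /=; lra.
- by rewrite /psum !big_cons big_nil /tbl /=; lra.
- by move=> [|[|[|[|c]]]]// [|[|[|[|d]]]]// _ _;
    rewrite /psum !big_cons big_nil /tbl /=; lra.
- by rewrite /psum !big_cons big_nil /tbl /=; lra.
- by rewrite /psum !big_cons big_nil /tbl /=; lra.
- by move=> [|[|[|[|c]]]]// _; rewrite /psum !big_cons big_nil /tbl /=; lra.
- by move=> [|[|[|[|c]]]]// _; rewrite /psum !big_cons big_nil /tbl /=; lra.
- by rewrite /psum !big_cons big_nil /tbl /=; lra.
- by rewrite /psum !big_cons big_nil /tbl /=; lra.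
Qed.

Lemma potential4 (R : realFieldType) : @potential R (619/1000) 4
  (tbl [:: 72/100; 9/10; 1; 1])
  (tbl [:: 384/1000; 729/1000; 1175/1000; 1175/1000])
  (tbl [:: 384/1000; 768/1000; 1392/1000; 1392/1000])
  (tbl [:: 363/1000; 853/1000; 1308/1000; 1308/1000])
  (106/100) (9/10) 1 3.
Proof.
split.
- lra.
- by move=> v; split; apply: tbl_gt0 => /=; rewrite !andbT; do ?[apply/andP; split]; lra.
- split; [split|]; lra.
- by move=> [|[|[|[|[|c]]]]]// _; rewrite /psum !big_cons big_nil /tbl /=; lra.
- by move=> [|[|[|[|[|c]]]]]// [|[|[|[|[|d]]]]]// _ _;
    rewrite /psum !big_cons big_nil /tbl /=; lra.
- by move=> [|[|[|[|[|c]]]]]// _; rewrite /psum !big_cons big_nil /tbl /=; lra.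
- by rewrite /psum !big_cons big_nil /tbl /=; lra.
- by rewrite /psum !big_cons big_nil /tbl /=; lra.
- by move=> [|[|[|[|[|c]]]]]// [|[|[|[|[|d]]]]]// _ _;
    rewrite /psum !big_cons big_nil /tbl /=; lra.
- by rewrite /psum !big_cons big_nil /tbl /=; lra.
- by rewrite /psum !big_cons big_nil /tbl /=; lra.
- by move=> [|[|[|[|[|c]]]]]// _; rewrite /psum !big_cons big_nil /tbl /=; lra.
- by move=> [|[|[|[|[|c]]]]]// _; rewrite /psum !big_cons big_nil /tbl /=; lra.
- by rewrite /psum !big_cons big_nil /tbl /=; lra.
- by rewrite /psum !big_cons big_nil /tbl /=; lra.
Qed.

Lemma geo_tail_le (R : realFieldType) (y : R) w n : 0 <= y -> y < 1 ->
  \sum_(v <- iota w n) y ^+ v <= y ^+ w / (1 - y).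
Proof.
move=> y0 y1; have d0 : 0 < 1 - y by lra.
rewrite ler_pdivlMr//; suff -> : (\sum_(v <- iota w n) y ^+ v) * (1 - y) = y ^+ w - y ^+ (w + n).
  by rewrite gerBl exprn_ge0.
elim: n w => [|n IHn] w /=; first by rewrite big_nil mul0r addn0 subrr.
by rewrite big_cons mulrDl IHn addSnnS exprS; ring.
Qed.

(** With [u] constant only the mirror inequalities are exploited. The first entry of a pair is
    charged [b], and the second, knowing its mirror [d], has to satisfy p <= v + d. *)
Lemma potential_flat (R : realFieldType) (y K : R) (p : nat) (b : nat -> R) :
  0 < y -> 0 < K <= 1 -> (forall v, 0 < b v) ->
  (forall d, (0 < d <= p)%N -> psum y p (fun v => p <= v + d)%N (fun=> 1) <= K * b d) ->
  psum y p xpredT b <= 1 -> psum y p (fun v => 1 < v)%N b <= K ->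
  psum y p xpredT (fun=> 1) <= 3 * K ->
  potential y p (fun=> 1) b b b 1 K 1 3.
Proof.
move=> y0 /andP[K0 K1] b0 tail bU bK self.
have le P Q f := psum_le R y p P Q f (ltW y0).
have b0' v : 0 <= b v by exact/ltW.
have tail1 d : (0 < d <= p)%N -> psum y p (fun v => p <= v + d)%N (fun=> 1) <= b d.
  by move=> /tail /le_trans; apply; rewrite ler_piMl.
have bm1 : (fun v => b v * 1) = b by apply/funext => v; rewrite mulr1.
split=> //; rewrite ?bm1 ?mulr1//.
- by move=> c _; apply: le_trans bU; apply: le.
- move=> c d _ dp; rewrite mul1r mulr1; apply: le_trans (tail1 d dp).
  by apply: le => // v /andP[].
- move=> c _; apply: (@le_trans _ _ (psum y p xpredT (fun=> 1))); first exact: le.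
  by apply: le_trans self _; rewrite ler_piMr.
- move=> c d _ dp; rewrite mulr1; apply: le_trans (tail1 d dp).
  by apply: le => // v /andP[].
- by move=> d dp; rewrite mul1r; exact: tail1.
- move=> d dp; apply: le_trans (tail d _); last by lia.
  by apply: le => // v /andP[].
- by apply: le_trans self _; rewrite ler_piMr.
- by apply: le_trans self; apply: le.
Qed.

(** [K] is 9/10 because for maximum 5 it must pay for the factor 106/100 of the right arc, where p =
    4. *)
Lemma potential5 (R : realFieldType) : exists b, @potential R (619/1000) 5
  (fun=> 1) b b b 1 (9/10) 1 3.
Proof.
exists (tbl [:: 265/1000; 528/1000; 954/1000; 1642/1000; 1642/1000]).
apply: potential_flat; rewrite ?/psum ?big_cons ?big_nil /tbl /=; [lra|lra| | |lra..].
  by move=> v; apply: tbl_gt0 => /=; rewrite !andbT; do ?[apply/andP; split]; lra.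
by move=> [|[|[|[|[|[|c]]]]]]// _; rewrite /psum !big_cons big_nil /tbl /=; lra.
Qed.

Lemma potential_ge6 (R : realFieldType) p : (6 <= p)%N ->
  exists b, @potential R (619/1000) p (fun=> 1) b b b 1 1 1 3.
Proof.
move=> p6; set y : R := 619/1000.
have y0 : 0 < y by rewrite /y; lra.
have y1 : y < 1 by rewrite /y; lra.
have d0 : 0 < 1 - y by rewrite subr_gt0.
(* This bounds the geometric tail of the values at least p - v. Using 6 in place of [p] only
   enlarges it and serves all p >= 6 at once. With 5 in place of 6 the estimate of [bU] below would
   exceed 1, hence the separate table for p = 5. *)
pose b v := y ^+ maxn 1 (6 - v) / (1 - y).
have b0 v : 0 < b v by rewrite divr_gt0// exprn_gt0.
have p5 : (5 <= p)%N by lia.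
have bU : psum y p xpredT b <= 1.
  rewrite /psum -(subnKC p5) iotaD big_cat /=.
  have -> : \sum_(v <- iota 6 (p - 5)) y ^+ v * b v =
      (y / (1 - y)) * \sum_(v <- iota 6 (p - 5)) y ^+ v.
    rewrite mulr_sumr; apply: eq_big_seq => v; rewrite mem_iota => hv.
    by rewrite mulrC /b; have -> : maxn 1 (6 - v) = 1%N by lia.
  apply: (@le_trans _ _ (5 * y ^+ 6 / (1 - y) + y / (1 - y) * (y ^+ 6 / (1 - y)))).
    rewrite lerD//; last first.
      apply: ler_wpM2l; first by rewrite divr_ge0// ltW.
      by apply: geo_tail_le => //; exact: ltW.
    rewrite !big_cons big_nil /b /maxn /= le_eqVlt; apply/orP; left; apply/eqP.
    ring.
  have -> : 1 - y = 381/1000 by rewrite /y; lra.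
  rewrite /y; lra.
have tail d : (0 < d <= p)%N -> psum y p (fun v => p <= v + d)%N (fun=> 1) <= 1 * b d.
  move=> dp; rewrite mul1r /psum.
  pose w := maxn 1 (6 - d).
  apply: (@le_trans _ _ (\sum_(v <- iota w (p.+1 - w)) y ^+ v)); last first.
    by rewrite /b -/w; apply: geo_tail_le; rewrite ?ltW//.
  have wp : (w.-1 <= p)%N by rewrite /w; lia.
  rewrite -{1}(subnKC wp) iotaD big_cat /= [X in X + _]big_seq_cond.
  rewrite [X in X + _]big1 ?add0r; last first.
    by move=> v; rewrite mem_iota /w => h; exfalso; lia.
  have -> : (1 + w.-1 = w)%N by rewrite /w; lia.
  have -> : (p - w.-1 = p.+1 - w)%N by rewrite /w; lia.
  rewrite big_mkcond; apply: ler_sum => v _.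
  by case: ifP; rewrite ?mulr1// exprn_ge0// ltW.
exists b; apply: potential_flat => //.
- by rewrite ltr01 lexx.
- apply: le_trans bU; rewrite /psum [leLHS]big_mkcond; apply: ler_sum => v _.
  by case: ifP => // _; rewrite mulr_ge0 ?exprn_ge0// ltW.
- rewrite /psum mulr1; apply: (@le_trans _ _ (y ^+ 1 / (1 - y))); last first.
    by have -> : 1 - y = 381/1000 by [rewrite /y; lra]; rewrite /y; lra.
  rewrite (eq_bigr (fun v => y ^+ v)); last by move=> v _; rewrite mulr1.
  by apply: geo_tail_le => //; exact: ltW.
Qed.

Definition arcU (R : realFieldType) (p : nat) : R :=
  if p == 3 then 11/10 else if p == 4 then 106/100 else 1.
Definition arcK (R : realFieldType) (p : nat) : R :=
  if p == 3 then 8/10 else if (p <= 5)%N then 9/10 else 1.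
Definition arcL (R : realFieldType) (p : nat) : R :=
  if p == 3 then 997/1000 else 1.

Lemma arc_sum619 (R : realFieldType) (p n a b : nat) :
  (3 <= p)%N -> (0 < a)%N -> (b <= a)%N ->
  \sum_(s <- lists p n | arc_ok p n a b s) (619/1000 : R) ^+ sumn s <=
  4 * (arcK R p ^+ minn b n * arcU R p ^+ (minn a n - minn b n) *
       arcL R p ^+ (n - a.*2)).
Proof.
move=> p3 a0 ba; have -> : 4 = 1 + 3 :> R by lra.
move: p p3 => [|[|[|[|[|[|p]]]]]]// _.
- exact: (arc_sum_le _ _ _ _ _ _ _ _ _ _ (potential3 R)).
- exact: (arc_sum_le _ _ _ _ _ _ _ _ _ _ (potential4 R)).
- by have [? H] := potential5 R; exact: (arc_sum_le _ _ _ _ _ _ _ _ _ _ H).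
- have [//|? H] := potential_ge6 R p.+2.+4; exact: (arc_sum_le _ _ _ _ _ _ _ _ _ _ H).
Qed.

(** * Kunz coordinates *)

Definition kz (s : seq nat) (i : nat) : nat := nth 0%N s i.-1.


(* [s] lists the Kunz coordinates [k_1, ..., k_(m-1)] with [m = size s + 1]. *)
Definition kunz (s : seq nat) : bool :=
  [&& all (leq 1) s,
      all (fun i => all (fun j => (i + j <= size s) ==>
             (kz s (i + j) <= kz s i + kz s j)) (iota 1 (size s)))
          (iota 1 (size s))
    & all (fun i => all (fun j => ((size s).+1 < i + j) ==>
             (kz s (i + j - (size s).+1) <= (kz s i + kz s j).+1))
             (iota 1 (size s))) (iota 1 (size s))]%N.

Lemma kunzP s :
  reflect [/\ forall i, (0 < i <= size s)%N -> (0 < kz s i)%N,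
     forall i j, (0 < i)%N -> (0 < j)%N -> (i + j <= size s)%N ->
       (kz s (i + j) <= kz s i + kz s j)%N
   & forall i j, (i <= size s)%N -> (j <= size s)%N -> ((size s).+1 < i + j)%N ->
       (kz s (i + j - (size s).+1) <= (kz s i + kz s j).+1)%N] (kunz s).
Proof.
apply: (iffP and3P) => -[H1 H2 H3]; split.
- move=> i hi; have hi1 : (i.-1 < size s)%N by lia.
  exact: (allP H1 _ (mem_nth 0%N hi1)).
- move=> i j i0 j0 ij.
  have hi : i \in iota 1 (size s) by rewrite mem_iota; lia.
  have hj : j \in iota 1 (size s) by rewrite mem_iota; lia.
  exact: (implyP (allP (allP H2 i hi) j hj) ij).
- move=> i j im jm ij.
  have hi : i \in iota 1 (size s) by rewrite mem_iota; lia.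
  have hj : j \in iota 1 (size s) by rewrite mem_iota; lia.
  exact: (implyP (allP (allP H3 i hi) j hj) ij).
- apply/(all_nthP 0%N) => i im; exact: (H1 i.+1).
- apply/allP => i; rewrite mem_iota => hi; apply/allP => j; rewrite mem_iota => hj.
  by apply/implyP => ij; apply: H2; lia.
- apply/allP => i; rewrite mem_iota => hi; apply/allP => j; rewrite mem_iota => hj.
  by apply/implyP => ij; apply: H3; lia.
Qed.

(** * Cutting a list at the last occurrence of its maximum *)

Section Decomposition.
Variables (s : seq nat) (q l a : nat).
Hypothesis l_rng : (0 < l <= size s)%N.
Hypothesis l_max : kz s l = q.
Lemma arcs_cat : s = take l.-1 s ++ q :: drop l s.
Proof.
rewrite -{1}(cat_take_drop l.-1 s); congr (_ ++ _).
rewrite (drop_nth 0%N); last lia.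
by rewrite -l_max; congr (_ :: drop _ s); lia.
Qed.

Hypothesis s_kunz : kunz s.
Hypothesis le_q : forall i, (0 < i <= size s)%N -> (kz s i <= q)%N.
Hypothesis lt_q : forall i, (l < i <= size s)%N -> (kz s i < q)%N.
Hypothesis a_rng : (0 < a)%N.
Hypothesis a_kz : (a <= size s)%N -> kz s a = 1%N.
Hypothesis a_min : forall i, (0 < i <= size s)%N -> (i < a)%N -> (1 < kz s i)%N.

Let nth_take1 t : (t < l.-1)%N -> nth 0%N (take l.-1 s) t = kz s t.+1.
Proof. by move=> tl; rewrite nth_take. Qed.

Let nth_drop1 t : nth 0%N (drop l s) t = kz s (l + t).+1.
Proof. by rewrite nth_drop. Qed.

(** Position t carries index t + 1, so mirror positions have indices with sum [l], and subadditivity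
    without wrap-around bounds [q] by the sum of their coordinates. *)
Lemma arc_left_ok : take l.-1 s \in lists q l.-1 /\
  arc_ok q l.-1 a a.-1 (take l.-1 s).
Proof.
have [K1 K2 K3] := kunzP _ s_kunz.
have szt : size (take l.-1 s) = l.-1 by rewrite size_takel//; lia.
split.
  rewrite mem_lists szt eqxx /=; apply/(all_nthP 0%N) => t; rewrite szt => tl.
  by rewrite nth_take1// K1 ?le_q//; lia.
apply/arc_okP; rewrite szt; split => [t tl tl'|t tl at_|t tl tb].
- rewrite !nth_take1// -l_max.
  have -> : l = (t.+1 + (l.-1.-1 - t).+1)%N by lia.
  have -> : ((t.+1 + (l.-1.-1 - t).+1).-1.-1 - t = l.-1.-1 - t)%N by lia.
  by apply: K2 => //; lia.
- rewrite !nth_take1//; last lia.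
  have -> : t.+1 = ((t - a).+1 + a)%N by lia.
  have := K2 (t - a).+1 a isT a_rng ltac:(lia).
  rewrite a_kz; last lia.
  by rewrite addn1.
- by rewrite nth_take1//; apply: a_min; lia.
Qed.

(** Position t carries index l + t + 1, so mirror positions have indices with sum l + m. The
    wrap-around inequality costs 1, which replaces [q] by q - 1; the entries are also at most q - 1,
    because [l] is the last place of the maximum. *)
Lemma arc_right_ok : drop l s \in lists q.-1 (size s - l) /\
  arc_ok q.-1 (size s - l) a (a.-1 - l) (drop l s).
Proof.
have [K1 K2 K3] := kunzP _ s_kunz.
have szt : size (drop l s) = (size s - l)%N by rewrite size_drop.
split.
  rewrite mem_lists szt eqxx /=; apply/(all_nthP 0%N) => t; rewrite szt => tl.
  rewrite nth_drop1 K1//; last lia.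
  by have := lt_q (l + t).+1 ltac:(lia); lia.
apply/arc_okP; rewrite szt; split => [t tl tl'|t tl at_|t tl tb].
- rewrite !nth_drop1.
  have := K3 (l + t).+1 (l + ((size s - l).-1 - t)).+1 ltac:(lia) ltac:(lia) ltac:(lia).
  have -> : ((l + t).+1 + (l + ((size s - l).-1 - t)).+1 - (size s).+1 = l)%N by lia.
  rewrite l_max; lia.
- rewrite !nth_drop1.
  have := K2 (l + (t - a)).+1 a isT a_rng ltac:(lia).
  have -> : ((l + (t - a)).+1 + a = (l + t).+1)%N by lia.
  by rewrite a_kz; [rewrite addn1|lia].
- by rewrite nth_drop1; apply: a_min; lia.
Qed.

End Decomposition.

Definition top (s : seq nat) : nat := \max_(v <- s) v.
Definition last_top (s : seq nat) : nat := (size s - index (top s) (rev s))%N.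
(** If no coordinate is 1, the value is [size s + 1], so all indices count as preceding it. *)
Definition first1 (s : seq nat) : nat := (index 1%N s).+1.

Lemma top_mem s : (0 < size s)%N -> top s \in s.
Proof.
rewrite /top; elim: s => // x s IHs _; rewrite big_cons inE.
case: s IHs => [|x' s] IHs; first by rewrite big_nil maxn0 eqxx.
rewrite /maxn; case: ifP => _; last by rewrite eqxx.
by rewrite IHs// orbT.
Qed.

Lemma kz_top s i : (0 < i <= size s)%N -> (kz s i <= top s)%N.
Proof.
move=> hi; have hi1 : (i.-1 < size s)%N by lia.
by rewrite /top /kz; apply: leq_bigmax_seq => //; exact: mem_nth.
Qed.

Lemma last_top_rng s : (0 < size s)%N -> (0 < last_top s <= size s)%N.
Proof.
move=> s0; rewrite /last_top leq_subr andbT subn_gt0.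
by rewrite -(size_rev s) index_mem mem_rev top_mem.
Qed.

Lemma kz_last_top s : (0 < size s)%N -> kz s (last_top s) = top s.
Proof.
move=> s0; have /andP[l0 ls] := last_top_rng s s0.
have ir : (index (top s) (rev s) < size s)%N.
  by rewrite -(size_rev s) index_mem mem_rev top_mem.
have := nth_index 0%N (_ : top s \in rev s).
rewrite mem_rev => /(_ (top_mem s s0)); rewrite nth_rev//.
by rewrite /kz /last_top subnS.
Qed.

Lemma kz_gt_last_top s i : (last_top s < i <= size s)%N -> (kz s i < top s)%N.
Proof.
move=> hi; rewrite ltn_neqAle kz_top ?andbT; last by lia.
apply/negP => /eqP ki.
have hi' : (size s - i < index (top s) (rev s))%N.
  by move: hi; rewrite /last_top; lia.
have := before_find 0%N hi'; rewrite nth_rev; last by lia.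
have -> : (size s - (size s - i).+1 = i.-1)%N by lia.
by rewrite -/(kz s i) ki /= eqxx.
Qed.

Lemma kz_first1 s : (first1 s <= size s)%N -> kz s (first1 s) = 1%N.
Proof. by rewrite /first1 /kz /= index_mem => ?; rewrite nth_index. Qed.

Lemma kz_lt_first1 s i : kunz s ->
  (0 < i <= size s)%N -> (i < first1 s)%N -> (1 < kz s i)%N.
Proof.
move=> /kunzP[K1 _ _] hi ia; rewrite ltn_neqAle K1// andbT eq_sym.
apply/negP => /eqP ki.
have hi' : (i.-1 < index 1%N s)%N by move: ia; rewrite /first1; lia.
by have := before_find 0%N hi'; rewrite -/(kz s i) ki.
Qed.

(** * Counting lists through their weight *)

Lemma ler_sum_sub (R : realFieldType) (T : eqType) (s s' : seq T) (f : T -> R) :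
  uniq s -> uniq s' -> {subset s <= s'} -> (forall x, 0 <= f x) ->
  \sum_(x <- s) f x <= \sum_(x <- s') f x.
Proof.
move=> us us' ss' f0; rewrite [leRHS](bigID (mem s)) /=.
have p : perm_eq s [seq x <- s' | x \in s].
  apply: uniq_perm; rewrite ?filter_uniq// => x; rewrite mem_filter.
  by case: (boolP (x \in s)) => // /ss' ->.
by rewrite [leLHS](perm_big _ p) big_filter lerDl sumr_ge0.
Qed.

(** All lists of [X] have the same weight y ^ g, so counting is weighing. The pair of arcs
    determines the list, since the entry between them is the fixed [q], and the weight factors
    accordingly. *)
Lemma size_mul_le (R : realFieldType) (y : R) (X : seq (seq nat))
    (g q l : nat) (L1 L2 : seq (seq nat)) (P1 P2 : pred (seq nat)) :
  0 <= y -> uniq X -> uniq L1 -> uniq L2 ->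
  (forall s, s \in X -> [/\ sumn s = g, s = take l.-1 s ++ q :: drop l s,
     (take l.-1 s \in L1) && P1 (take l.-1 s) &
     (drop l s \in L2) && P2 (drop l s)]) ->
  (size X)%:R * y ^+ g <=
  y ^+ q * (\sum_(s <- L1 | P1 s) y ^+ sumn s) * (\sum_(s <- L2 | P2 s) y ^+ sumn s).
Proof.
move=> y0 uX uL1 uL2 HX.
pose f (s : seq nat) := (take l.-1 s, drop l s).
pose L := [seq (s1, s2) | s1 <- [seq s <- L1 | P1 s], s2 <- [seq s <- L2 | P2 s]].
have fX_sub : {subset map f X <= L}.
  move=> _ /mapP[s /HX[_ _ /andP[h1 h2] /andP[h3 h4]] ->].
  by apply/allpairsP; exists (f s); rewrite !mem_filter h1 h2 h3 h4.
have ufX : uniq (map f X).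
  rewrite map_inj_in_uniq// => s s' /HX[_ e1 _ _] /HX[_ e2 _ _] [e3 e4].
  by rewrite e1 e2 e3 e4.
have -> : (size X)%:R * y ^+ g =
    \sum_(u <- map f X) y ^+ q * (y ^+ sumn u.1 * y ^+ sumn u.2).
  rewrite big_map -sum1_size natr_sum mulr_suml; apply: eq_big_seq => s /HX[<- e _ _].
  by rewrite mul1r {1}e sumn_cat /= !exprD; ring.
apply: (@le_trans _ _ (\sum_(u <- L) y ^+ q * (y ^+ sumn u.1 * y ^+ sumn u.2))).
  apply: ler_sum_sub => //; last by move=> u; rewrite !mulr_ge0 ?exprn_ge0.
  by apply: allpairs_uniq; rewrite ?filter_uniq// => -[? ?] [? ?] _ _ /=.
rewrite -mulr_sumr /L big_allpairs_dep /= -mulrA le_eqVlt; apply/orP; left; apply/eqP.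
congr (_ * _); rewrite -[in RHS]big_filter -[X in _ * X]big_filter mulr_suml.
by apply: eq_bigr => s _; rewrite mulr_sumr.
Qed.

Lemma sum_lists2 (R : realFieldType) (y : R) n :
  \sum_(s <- lists 2 n) y ^+ sumn s = (y + y ^+ 2) ^+ n.
Proof.
elim: n => [|n IHn]; first by rewrite big_seq1 /= !expr0.
rewrite [lists 2 n.+1](_ : _ = [seq rcons s v | s <- lists 2 n, v <- iota 1 2])//.
rewrite big_allpairs_dep exprSr -IHn mulr_suml; apply: eq_bigr => s _.
by rewrite /= !big_cons big_nil !sumn_rcons !exprD expr1 addr0 mulrDr.
Qed.

Lemma count_top_le2 (R : realFieldType) (y : R) (X : seq (seq nat)) g k :
  0 <= y -> uniq X ->
  (forall s, s \in X -> sumn s = g /\ s \in lists 2 k) ->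
  (size X)%:R * y ^+ g <= (y + y ^+ 2) ^+ k.
Proof.
move=> y0 uX HX; rewrite -sum_lists2.
have -> : (size X)%:R * y ^+ g = \sum_(s <- X) y ^+ sumn s.
  rewrite -sum1_size natr_sum mulr_suml; apply: eq_big_seq => s /HX[-> _].
  by rewrite mul1r.
apply: ler_sum_sub => //; first exact: uniq_lists.
  by move=> s /HX[].
by move=> s; rewrite exprn_ge0.
Qed.

Lemma arcs_le (R : realFieldType) (y : R) (X : seq (seq nat)) g k q l a :
  0 <= y -> uniq X -> X != [::] ->
  (forall s, s \in X -> [/\ kunz s, sumn s = g, size s = k & (0 < k)%N] /\
     [/\ top s = q, last_top s = l & first1 s = a]) ->
  [/\ (0 < l <= k)%N, (0 < a)%N &
  (size X)%:R * y ^+ g <= y ^+ q *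
    (\sum_(s <- lists q l.-1 | arc_ok q l.-1 a a.-1 s) y ^+ sumn s) *
    (\sum_(s <- lists q.-1 (k - l) | arc_ok q.-1 (k - l) a (a.-1 - l) s)
       y ^+ sumn s)].
Proof.
move=> y0 uX Xn0 HX.
have [s0 s0X] : exists s, s \in X.
  by case: X Xn0 {uX HX} => // s X _; exists s; rewrite mem_head.
have [[_ _ sk k0] [_ sl sa]] := HX _ s0X.
split; [by rewrite -sl -sk last_top_rng// sk|by rewrite -sa|].
apply: size_mul_le; rewrite ?uniq_lists// => s sX.
have [[sK sg ssk _] [tq lq aq]] := HX _ sX.
have ss0 : (0 < size s)%N by rewrite ssk.
have lr : (0 < l <= size s)%N by rewrite -lq last_top_rng.
have lm : kz s l = q by rewrite -lq kz_last_top.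
have leq' i : (0 < i <= size s)%N -> (kz s i <= q)%N by rewrite -tq; exact: kz_top.
have ltq i : (l < i <= size s)%N -> (kz s i < q)%N.
  by rewrite -tq -lq; exact: kz_gt_last_top.
have ak : (a <= size s)%N -> kz s a = 1%N by rewrite -aq; exact: kz_first1.
have am i : (0 < i <= size s)%N -> (i < a)%N -> (1 < kz s i)%N.
  by rewrite -aq; exact: kz_lt_first1.
have a0 : (0 < a)%N by rewrite -aq.
split=> //.
- exact: (arcs_cat s q l).
- by apply/andP; apply: (arc_left_ok s q l a).
- by apply/andP; rewrite -ssk; apply: (arc_right_ok s q l a).
Qed.

Lemma arc_csts (R : realFieldType) p :
  [/\ 1 <= arcU R p <= 11/10, 0 < arcK R p <= 1 & 0 < arcL R p <= 1].
Proof.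
by rewrite /arcU /arcK /arcL; split; do ![case: ifP => _]; apply/andP; split; lra.
Qed.

Lemma arcUK (R : realFieldType) q : (4 <= q)%N -> arcU R q.-1 * arcK R q <= 1.
Proof.
by move: q => [|[|[|[|[|[|q]]]]]]// _; rewrite /arcU /arcK /=; lra.
Qed.

(** With b = a - 1 at most one position of the left arc is charged [U], and 44/10 = 4 * 11/10
    absorbs it. *)
Lemma arc_sum_left (R : realFieldType) p n a : (3 <= p)%N -> (0 < a)%N ->
  \sum_(s <- lists p n | arc_ok p n a a.-1 s) (619/1000 : R) ^+ sumn s <=
  44/10 * (arcK R p ^+ minn a.-1 n * arcL R p ^+ (n - a.*2)).
Proof.
move=> p3 a0; apply: le_trans (arc_sum619 R p n a a.-1 p3 a0 (leq_pred _)) _.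
have [/andP[U1 U1'] /andP[K1 K1'] /andP[L1 L1']] := arc_csts R p.
have -> : 44/10 = 4 * (11/10) :> R by clear; lra.
rewrite -[leRHS]mulrA ler_wpM2l// [leRHS]mulrC mulrAC.
rewrite ler_wpM2l//; first by rewrite mulr_ge0// exprn_ge0// ltW.
have : (minn a n - minn a.-1 n <= 1)%N by lia.
by case: (_ - _)%N => [|[|]]// _; rewrite (le_trans _ U1').
Qed.

Lemma arc_sum_right (R : realFieldType) p n a b :
  (3 <= p)%N -> (0 < a)%N -> (b <= a)%N ->
  \sum_(s <- lists p n | arc_ok p n a b s) (619/1000 : R) ^+ sumn s <=
  4 * arcU R p ^+ (minn a n - minn b n).
Proof.
move=> p3 a0 ba; apply: le_trans (arc_sum619 R p n a b p3 a0 ba) _.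
have [/andP[U1 U1'] /andP[K1 K1'] /andP[L1 L1']] := arc_csts R p.
rewrite ler_wpM2l//.
have h : 0 <= arcU R p ^+ (minn a n - minn b n) by rewrite exprn_ge0// (le_trans ler01).
rewrite -[leRHS]mulr1 ler_pM//.
- by rewrite mulr_ge0// exprn_ge0// ltW.
- by rewrite exprn_ge0// ltW.
- by rewrite ler_piMl// exprn_ile1// ltW.
- by rewrite exprn_ile1// ltW.
Qed.

(* A factor [arcU q.-1] of the right arc is always paid for by a factor
   [arcK q] of the left arc. *)
Lemma count_top_ge4 (R : realFieldType) (X : seq (seq nat)) g k q l a :
  (4 <= q)%N -> uniq X ->
  (forall s, s \in X -> [/\ kunz s, sumn s = g, size s = k & (0 < k)%N] /\
     [/\ top s = q, last_top s = l & first1 s = a]) ->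
  (size X)%:R * (619/1000 : R) ^+ g <= 25.
Proof.
move=> q4 uX HX; have [->|Xn0] := eqVneq X [::]; first by rewrite mul0r ler0n.
have y0 : 0 <= 619/1000 :> R by clear; lra.
have y1 : 619/1000 <= 1 :> R by clear; lra.
have [lk a0 H] := arcs_le R _ X g k q l a y0 uX Xn0 HX.
apply: (le_trans H) => {H HX uX Xn0}.
have q3 : (3 <= q)%N by lia.
have q3' : (3 <= q.-1)%N by lia.
have ba : (a.-1 - l <= a)%N by lia.
have H1 := arc_sum_left R q l.-1 a q3 a0.
have H2 := arc_sum_right R q.-1 (k - l) a (a.-1 - l) q3' a0 ba.
(* The positions of the right arc charged [U] lie from [a.-1 - l] up to a - 1. They outnumber the
   left positions charged [K] by at most 2, and 44/10 * 4 * (11/10)^2 < 25. *)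
have expo : (minn a (k - l) - minn (a.-1 - l) (k - l) <= minn a.-1 l.-1 + 2)%N by clear -lk a0; lia.
move: (arc_csts R q) => [/andP[U1 U1'] /andP[K1 K1'] /andP[L1 L1']].
move: (arc_csts R q.-1) => [/andP[U2 U2'] _ _].
have h1 : arcK R q ^+ minn a.-1 l.-1 * arcL R q ^+ (l.-1 - a.*2) <=
    arcK R q ^+ minn a.-1 l.-1.
  rewrite -[leRHS]mulr1; apply: ler_wpM2l; first by rewrite exprn_ge0// ltW.
  by rewrite exprn_ile1// ltW.
have h2 : arcU R q.-1 ^+ (minn a (k - l) - minn (a.-1 - l) (k - l)) <=
    arcU R q.-1 ^+ minn a.-1 l.-1 * arcU R q.-1 ^+ 2.
  by rewrite -exprD ler_weXn2l.
have h3 : (arcU R q.-1 * arcK R q) ^+ minn a.-1 l.-1 <= 1.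
  apply: exprn_ile1; last exact: arcUK.
  by apply: mulr_ge0; [exact: le_trans ler01 U2|exact: ltW].
have yq : (619/1000 : R) ^+ q <= 1 by exact: exprn_ile1.
have u0 : 0 <= arcU R q.-1 ^+ minn a.-1 l.-1 by rewrite exprn_ge0// (le_trans ler01).
have k0 : 0 <= arcK R q ^+ minn a.-1 l.-1 by rewrite exprn_ge0// ltW.
rewrite exprMn in h3; rewrite expr2 in h2.
have yq0 : 0 <= (619/1000 : R) ^+ q by exact: exprn_ge0.
have S10 : 0 <= \sum_(s <- lists q l.-1 | arc_ok q l.-1 a a.-1 s) (619/1000 : R) ^+ sumn s.
  by apply: sumr_ge0 => s _; exact: exprn_ge0.
have S20 : 0 <= \sum_(s <- lists q.-1 (k - l) | arc_ok q.-1 (k - l) a (a.-1 - l) s)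
    (619/1000 : R) ^+ sumn s.
  by apply: sumr_ge0 => s _; exact: exprn_ge0.
have {h2}H2 := le_trans H2 (ler_wpM2l (ler0n R 4) h2).
have c0 : 0 <= 44/10 :> R by clear; lra.
have {h1}H1 := le_trans H1 (ler_wpM2l c0 h1).
apply: le_trans (ler_pM (mulr_ge0 yq0 S10) S20 (ler_pM yq0 S10 yq H1) H2) _.
clear -h3 U2 U2' u0 k0.
move: (arcU _ _ ^+ _) (arcK _ _ ^+ _) h3 u0 k0 => u v h3 u0 v0.
have -> : 1 * (44/10 * v) * (4 * (u * (arcU R q.-1 * arcU R q.-1))) =
  (44/10 * 4) * (u * v) * (arcU R q.-1 * arcU R q.-1) by ring.
have h : arcU R q.-1 * arcU R q.-1 <= 11/10 * (11/10).
  by rewrite ler_pM ?(le_trans ler01).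
apply: (@le_trans _ _ ((44/10 * 4) * 1 * (11/10 * (11/10)))); last lra.
have U0 := le_trans ler01 U2.
have c0 : 0 <= 44/10 * 4 :> R by clear; lra.
apply: ler_pM => //; last exact: ler_wpM2l.
- exact: mulr_ge0 c0 (mulr_ge0 u0 v0).
- exact: mulr_ge0.
Qed.

(** Wherever the first 1 lies, about half of the left arc yields a gain: the coordinates before it
    cost 8/10, the positions with both neighbours at distance [a] cost 997/1000. *)
Lemma half_arc_le l a : (0 < a)%N ->
  ((l - 3)./2 <= minn a.-1 l.-1 + (l.-1 - a.*2))%N.
Proof.
move=> a0; rewrite -[leqRHS]doubleK; apply: half_leq; lia.
Qed.

(** The right arc has entries in {1, 2} and is bounded by the sum over all such lists. The weight
    [y] stays variable, to be tilted later; the left arc is monotone in [y] and is estimated at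
    619/1000. *)
Lemma count_top3 (R : realFieldType) (y : R) (X : seq (seq nat)) g k l a :
  0 < y <= 619/1000 -> uniq X ->
  (forall s, s \in X -> [/\ kunz s, sumn s = g, size s = k & (0 < k)%N] /\
     [/\ top s = 3, last_top s = l & first1 s = a]) ->
  (size X)%:R * y ^+ g <= 5 * (997/1000) ^+ (l - 3)./2 * (y + y ^+ 2) ^+ (k - l).
Proof.
move=> /andP[y0 y1] uX HX.
have c1 : 619/1000 <= 1 :> R by clear; lra.
have c2 : 0 <= 997/1000 :> R by clear; lra.
have c3 : 997/1000 <= 1 :> R by clear; lra.
have c4 : 0 <= 8/10 :> R by clear; lra.
have c5 : 8/10 <= 997/1000 :> R by clear; lra.
have c6 : 0 <= 44/10 :> R by clear; lra.
have c7 : 44/10 <= 5 :> R by clear; lra.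
have c8 : 0 <= 619/1000 :> R by clear; lra.
have P20 : 0 <= (y + y ^+ 2) ^+ (k - l).
  by apply: exprn_ge0; apply: addr_ge0; [|apply: exprn_ge0]; exact: ltW.
have [->|Xn0] := eqVneq X [::].
  by rewrite mul0r !mulr_ge0// exprn_ge0.
have [lk a0 H] := arcs_le R _ X g k 3 l a (ltW y0) uX Xn0 HX.
apply: (le_trans H) => {H HX uX Xn0}.
have H1 := arc_sum_left R 3 l.-1 a isT a0.
rewrite /arcK /arcL /= in H1.
have expo : ((l - 3)./2 <= minn a.-1 l.-1 + (l.-1 - a.*2))%N by exact: half_arc_le.
set S1 := \sum_(s <- _ | _) _; set S2 := \sum_(s <- _ | _) _.
have S10 : 0 <= S1 by apply: sumr_ge0 => s _; rewrite exprn_ge0// ltW.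
have S20 : 0 <= S2 by apply: sumr_ge0 => s _; rewrite exprn_ge0// ltW.
have yq : y ^+ 3 <= 1 by apply: exprn_ile1; [exact: ltW|exact: le_trans y1 c1].
have yq0 : 0 <= y ^+ 3 by rewrite exprn_ge0// ltW.
have B1 : S1 <= 5 * (997/1000) ^+ (l - 3)./2.
  apply: (@le_trans _ _ (\sum_(s <- lists 3 l.-1 | arc_ok 3 l.-1 a a.-1 s)
     (619/1000 : R) ^+ sumn s)).
    by apply: ler_sum => s _; rewrite lerXn2r// nnegrE ltW.
  apply: (le_trans H1).
  rewrite ler_pM//; first by rewrite mulr_ge0// exprn_ge0.
  apply: (@le_trans _ _ ((997/1000) ^+ minn a.-1 l.-1 * (997/1000) ^+ (l.-1 - a.*2))).
    by rewrite ler_wpM2r ?exprn_ge0// lerXn2r// nnegrE.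
  by rewrite -exprD ler_wiXn2l.
have B2 : S2 <= (y + y ^+ 2) ^+ (k - l).
  rewrite -sum_lists2 /S2 [leLHS]big_mkcond; apply: ler_sum => s _.
  by case: ifP => // _; rewrite exprn_ge0// ltW.
have := ler_pM (mulr_ge0 yq0 S10) S20 (ler_pM yq0 S10 yq B1) B2.
by rewrite mul1r.
Qed.

(** * Atypical Kunz coordinates are exponentially rare *)

Definition kunzs (g : nat) : seq (seq nat) :=
  [seq s <- [seq s | k <- iota 0 g.+1, s <- lists g k] | kunz s && (sumn s == g)].

Lemma leq_nth_sumn s i : (nth 0 s i <= sumn s)%N.
Proof.
elim: s i => [|v s IHs] [|i] //=; first by rewrite leq_addr.
by rewrite (leq_trans (IHs i))// leq_addl.
Qed.

Lemma size_le_sumn s : all (leq 1) s -> (size s <= sumn s)%N.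
Proof. by elim: s => //= v s IHs /andP[v0 /IHs]; lia. Qed.

Lemma mem_kunzs g s : (s \in kunzs g) = kunz s && (sumn s == g).
Proof.
rewrite mem_filter andb_idr// => /andP[/and3P[s1 _ _] /eqP sg].
apply/allpairsPdep; exists (size s), s; split => //.
  by rewrite mem_iota add0n ltnS -sg size_le_sumn.
rewrite mem_lists eqxx; apply/(all_nthP 0%N) => i si.
by rewrite -sg leq_nth_sumn andbT; exact: (all_nthP 0%N s1).
Qed.

Lemma uniq_kunzs g : uniq (kunzs g).
Proof.
apply: filter_uniq; apply: allpairs_uniq_dep => //.
- exact: iota_uniq.
- by move=> k _; exact: uniq_lists.
- move=> _ _ /allpairsPdep[k [s [_ + ->]]] /allpairsPdep[k' [s' [_ + ->]]] /= ss'.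
  by rewrite !mem_lists ss' => /andP[/eqP <- _] /andP[/eqP <- _].
Qed.

(** * Lower bound for the number of semigroups *)

Lemma kunz12 s : all (fun v => 0 < v <= 2)%N s -> kunz s.
Proof.
move=> s12; have H i : (0 < i <= size s)%N -> (0 < kz s i <= 2)%N.
  by move=> hi; apply: (all_nthP 0%N s12); lia.
apply/kunzP; split=> [i /H|i j i0 j0 ij|i j im jm ij]; first by case/andP.
- have h1 := H i; have h2 := H j; have h3 := H (i + j)%N; lia.
- have h1 := H i; have h2 := H j; have h3 := H (i + j - (size s).+1)%N; lia.
Qed.

(** The compositions of [g] into parts 1 and 2, counted by Fibonacci numbers. *)
Fixpoint comp12 (g : nat) : seq (seq nat) :=
  match g with
  | 0 => [:: [::]]
  | g'.+1 => map (cons 1%N) (comp12 g') ++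
     match g' with 0 => [::] | g''.+1 => map (cons 2) (comp12 g'') end
  end.

Lemma comp12S g : comp12 g.+2 = map (cons 1%N) (comp12 g.+1) ++ map (cons 2) (comp12 g).
Proof. by []. Qed.

Lemma mem_comp12 g s : s \in comp12 g ->
  all (fun v => 0 < v <= 2)%N s && (sumn s == g).
Proof.
elim: g {-2}g (leqnn g) s => [|n IHn] [|[|g]] gn s.
- by rewrite inE => /eqP->.
- by [].
- by [].
- by rewrite inE => /eqP->.
- by rewrite inE => /eqP->.
- rewrite comp12S mem_cat => /orP[] /mapP[s' s'g ->] /=.
    have := IHn g.+1 ltac:(lia) s' s'g => /andP[-> /eqP->].
    by rewrite add1n eqxx.
  have := IHn g ltac:(lia) s' s'g => /andP[-> /eqP->].
  by rewrite add2n eqxx.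
Qed.

Lemma uniq_comp12 g : uniq (comp12 g).
Proof.
elim: g {-2}g (leqnn g) => [|n IHn] [|[|g]] gn //.
have u1 : uniq (comp12 g.+1) by apply: IHn; lia.
have u2 : uniq (comp12 g) by apply: IHn; lia.
have i1 v : injective (cons v : seq nat -> seq nat) by move=> ? ? [].
rewrite comp12S cat_uniq !(map_inj_uniq (i1 _)) u1 u2 andbT /=. by apply/hasPn => _ /mapP[s _ ->]; apply/mapP => -[].
Qed.

Section Golden.
Context {R : realType}.
Definition gold : R := (Num.sqrt 5 - 1) / 2.

Lemma gold_sqr : gold ^+ 2 = 1 - gold.
Proof.
have s5 : Num.sqrt 5 ^+ 2 = 5 :> R by rewrite sqr_sqrtr.
rewrite /gold; move: (Num.sqrt 5) s5 => r r5.
have -> : ((r - 1) / 2) ^+ 2 = (r ^+ 2 - 2 * r + 1) / 4 by field.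
by rewrite r5; field.
Qed.

Lemma gold_bounds : 618/1000 < gold < 6181/10000.
Proof.
have s5 : Num.sqrt 5 ^+ 2 = 5 :> R by rewrite sqr_sqrtr.
have s0 : 0 <= Num.sqrt 5 :> R by exact: sqrtr_ge0.
rewrite /gold; move: (Num.sqrt 5) s5 s0 => r r5 r0.
apply/andP; split; nra.
Qed.

(** Weighting the parts 1 and 2 by [x] and [x^2] gives mean part x + 2 x^2 = 2 - x, so [gamma] is
    the typical number of parts per unit of genus. *)
Lemma gamma_gold : gamma R * (2 - gold) = 1.
Proof.
have s5 : Num.sqrt 5 ^+ 2 = 5 :> R by rewrite sqr_sqrtr.
rewrite /gold /gamma; move: (Num.sqrt 5) s5 => r r5.
have -> : (5 + r) / 10 * (2 - (r - 1) / 2) = (25 - r ^+ 2) / 20 by field.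
by rewrite r5; field.
Qed.

Lemma gamma_bounds : 723/1000 < gamma R < 724/1000.
Proof.
have := gamma_gold; have := gold_bounds; move: gold (gamma R) => x c /andP[h1 h2] h3.
apply/andP; split; nra.
Qed.

(** For u_g = size (comp12 g) * gold ^ g the Fibonacci recursion becomes u_(g+2) = x u_(g+1) + (1 -
    x) u_g, a convex combination, so u never drops below the smaller initial value [gold]. *)
Lemma size_kunzs_ge g : gold <= (size (kunzs g))%:R * gold ^+ g.
Proof.
have /andP[x0 x1] := gold_bounds.
have x00 : 0 <= gold by lra.
apply: (@le_trans _ _ ((size (comp12 g))%:R * gold ^+ g)); last first.
  rewrite ler_wpM2r ?exprn_ge0// ler_nat; apply: uniq_leq_size.
    exact: uniq_comp12.
  by move=> s /mem_comp12 /andP[s12 sg]; rewrite mem_kunzs sg kunz12.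
elim: g {-2}g (leqnn g) => [|n IHn] [|[|g]] gn //.
- by rewrite expr0 mulr1 /=; lra.
- by rewrite expr0 mulr1 /=; lra.
- by rewrite expr1 /= mul1r.
rewrite comp12S size_cat !size_map natrD mulrDl.
have h1 := IHn g.+1 gn; have h2 := IHn g (ltnW gn).
have -> : (size (comp12 g.+1))%:R * gold ^+ g.+2 =
  gold * ((size (comp12 g.+1))%:R * gold ^+ g.+1) by rewrite exprS; ring.
have -> : (size (comp12 g))%:R * gold ^+ g.+2 =
  gold ^+ 2 * ((size (comp12 g))%:R * gold ^+ g) by rewrite -(addn2 g) exprD; ring.
rewrite gold_sqr.
move: (_ * gold ^+ g.+1) (_ * gold ^+ g) h1 h2 => u v h1 h2.
nra.
Qed.
End Golden.

Lemma size_le_keys (R : realFieldType) (T : eqType) (X : seq (seq nat))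
    (f : seq nat -> T) (Ks : seq T) (B : R) :
  (forall s, s \in X -> f s \in Ks) ->
  (forall c, c \in Ks -> (size [seq s <- X | f s == c])%:R <= B) ->
  (size X)%:R <= (size Ks)%:R * B.
Proof.
move=> fX HB; apply: (@le_trans _ _ (\sum_(c <- Ks) (size [seq s <- X | f s == c])%:R)).
  rewrite -natr_sum ler_nat.
  under eq_bigr do rewrite -sum1_size big_filter big_mkcond /=.
  rewrite exchange_big /= -sum1_size [leqLHS]big_seq [leqRHS]big_seq.
  apply: leq_sum => s /fX sK; rewrite -big_mkcond sum1_count -has_count.
  by apply/hasP; exists (f s).
rewrite -[(size Ks)%:R]mulr1 -sum1_size natr_sum mulr1 mulr_suml.
by rewrite big_seq [leRHS]big_seq; apply: ler_sum => c /HB; rewrite mul1r.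
Qed.

Lemma frac_le (R : realFieldType) (eta : R) (D e m : nat) :
  0 <= eta -> 4 <= eta * D%:R -> (e * D <= m)%N -> e%:R <= eta / 4 * m%:R.
Proof.
move=> eta0 etaD eD.
have h1 : e%:R * 4 <= e%:R * (eta * D%:R) by rewrite ler_wpM2l.
have h2 : eta * (e%:R * D%:R) <= eta * m%:R.
  by apply: ler_wpM2l => //; rewrite -natrM ler_nat.
rewrite mulrCA in h1.
by rewrite mulrAC ler_pdivlMr// (le_trans h1).
Qed.

(** * Exponential tilting of the weight *)

Section Tilt.
Context {R : realType}.
Local Notation x := (@gold R).

Lemma tilt_le (a y d B : R) (g : nat) : 0 <= a -> 0 < y ->
  x <= y * expR d -> a * y ^+ g <= B -> a * x ^+ g <= B * expR (d * g%:R).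
Proof.
move=> a0 y0 xy aB; have /andP[x0 _] := @gold_bounds R.
have xx0 : 0 <= x by lra.
apply: (@le_trans _ _ (a * (y * expR d) ^+ g)).
  rewrite ler_wpM2l// lerXn2r// nnegrE// (le_trans xx0)//.
by rewrite exprMn mulrA mulrC -expRM_natl mulrC [d * _]mulrC ler_wpM2r// expR_ge0.
Qed.

Lemma pow_expR (b e : R) (n : nat) : 0 <= b -> b <= expR e ->
  b ^+ n <= expR (e * n%:R).
Proof.
by move=> b0 be; rewrite mulrC expRM_natl lerXn2r ?nnegrE// (le_trans b0).
Qed.

Lemma tilt_up (d : R) : 0 <= d <= 1/2 -> x <= (x * (1 + d)) * expR (d ^+ 2 - d).
Proof.
move=> /andP[d0 d1]; have /andP[x0 _] := @gold_bounds R.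
have h := expR_ge1Dx (d ^+ 2 - d).
rewrite -mulrA ler_peMr//; first by lra.
apply: (@le_trans _ _ ((1 + d) * (1 + (d ^+ 2 - d)))).
  have -> : (1 + d) * (1 + (d ^+ 2 - d)) = 1 + d ^+ 3 by ring.
  by rewrite lerDl exprn_ge0.
by rewrite ler_wpM2l//; lra.
Qed.

Lemma tilt_down (d : R) : 0 <= d <= 1/2 -> x <= (x * (1 - d)) * expR (d + 2 * d ^+ 2).
Proof.
move=> /andP[d0 d1]; have /andP[x0 _] := @gold_bounds R.
have h := expR_ge1Dx (d + 2 * d ^+ 2).
rewrite -mulrA ler_peMr//; first by lra.
apply: (@le_trans _ _ ((1 - d) * (1 + (d + 2 * d ^+ 2)))); last first.
  by rewrite ler_wpM2l//; lra.
have -> : (1 - d) * (1 + (d + 2 * d ^+ 2)) = 1 + d ^+ 2 * (1 - 2 * d) by ring.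
by rewrite lerDl mulr_ge0 ?exprn_ge0//; lra.
Qed.

(** At [x] the sum y + y^2 equals 1, and its derivative in log y is x + 2 x^2 = 2 - x. *)
Lemma tilt_sum (d : R) : x * (1 + d) + (x * (1 + d)) ^+ 2 <= expR (d * (2 - x) + d ^+ 2).
Proof.
have /andP[x0 x1] := @gold_bounds R.
apply: le_trans (expR_ge1Dx _).
have -> : x * (1 + d) + (x * (1 + d)) ^+ 2 = x * (1 + d) + x ^+ 2 * (1 + d) ^+ 2 by ring.
rewrite gold_sqr.
have -> : x * (1 + d) + (1 - x) * (1 + d) ^+ 2 = 1 + d * (2 - x) + (1 - x) * d ^+ 2 by ring.
rewrite -addrA lerD2l lerD2l ler_piMl ?sqr_ge0//; lra.
Qed.

Let sum_ge0 (d : R) : -1 < d -> 0 <= x * (1 + d) + (x * (1 + d)) ^+ 2.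
Proof.
move=> d1; have /andP[x0 x1] := @gold_bounds R.
by rewrite addr_ge0 ?exprn_ge0// mulr_ge0//; [clear -x0|clear -d1|clear -x0|clear -d1]; lra.
Qed.

(** The terms d * c * (2 - z) and -d cancel. What remains is at most -d * eta, plus second order
    terms of at most 2 d^2 <= d * eta / 2. *)
Lemma exponent_low (c z eta d : R) : 0 <= d <= 1/2 -> 4 * d <= eta ->
  c * (2 - z) = 1 -> z <= 1 -> c <= 1 ->
  (d * (2 - z) + d ^+ 2) * (c - eta) + (d ^+ 2 - d) <= - (eta * d / 2).
Proof.
move=> /andP[d0 d1] de cz z1 c1.
have -> : (d * (2 - z) + d ^+ 2) * (c - eta) + (d ^+ 2 - d) =
   d * (c * (2 - z)) - d * eta * (2 - z) + d ^+ 2 * (c - eta + 1) - d by ring.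
have h2 : d ^+ 2 * (c - eta + 1) <= d ^+ 2 * 2.
  by rewrite ler_wpM2l ?sqr_ge0//; clear cz; lra.
have h3 : d * eta * 1 <= d * eta * (2 - z).
  by rewrite ler_wpM2l ?mulr_ge0//; clear -z1 de d0; lra.
have h4 : d * (4 * d) <= d * eta by rewrite ler_wpM2l.
rewrite cz [eta * d]mulrC; move: h2 h3 h4; rewrite expr2.
have -> : d * (4 * d) = 4 * (d * d) by ring.
have -> : d * eta * (2 - z) = 2 * (d * eta) - d * eta * z by ring.
move: (d * eta) (d * d) (d * eta * z) (d * d * (_ + _)) => v u t w h2 h3 h4.
clear -h2 h3 h4; lra.
Qed.

(* Chernoff bounds: tilting the weight [x] to [x * (1 + d)] or [x * (1 - d)]
   gains exponentially in [g], because [gamma R * (2 - x) = 1] balances the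
   first order terms exactly at multiplicity [gamma R * g]. *)
Lemma weight_low (a B eta d : R) (g n k : nat) :
  0 <= a -> 0 <= B -> 0 <= d <= 1/2 -> 4 * d <= eta -> 
  (n <= k)%N -> k%:R <= (gamma R - eta) * g%:R ->
  a * (x * (1 + d)) ^+ g <= B * (x * (1 + d) + (x * (1 + d)) ^+ 2) ^+ n ->
  a * x ^+ g <= B * expR (- (eta * d / 2) * g%:R).
Proof.
move=> a0 B0 d01 de nk kg H; have /andP[d0 d1] := d01.
have /andP[x0 x1] := @gold_bounds R.
have xp : 0 < x by clear -x0; lra.
have y0 : 0 < x * (1 + d) by rewrite mulr_gt0//; clear -d0; lra.
have dm : -1 < d by clear -d0; lra.
have H1 := le_trans H (ler_wpM2l B0 (pow_expR _ _ n (sum_ge0 d dm) (tilt_sum d))).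
have H2 := tilt_le a _ _ _ g a0 y0 (tilt_up d d01) H1.
apply: (le_trans H2) => {H H1 H2}; rewrite -[leLHS]mulrA -expRD ler_wpM2l// ler_expR.
have h1 : (d * (2 - x) + d ^+ 2) * n%:R <= (d * (2 - x) + d ^+ 2) * ((gamma R - eta) * g%:R).
  rewrite ler_wpM2l//; last by rewrite (le_trans _ kg)// ler_nat.
  by rewrite addr_ge0 ?sqr_ge0// mulr_ge0//; clear -x1; lra.
apply: (le_trans (lerD h1 (lexx _))).
rewrite mulrA -mulrDl ler_wpM2r//.
have /andP[c0 c1] := @gamma_bounds R.
apply: exponent_low => //; [exact: gamma_gold|clear -x1; lra|clear -c1; lra].
Qed.

Lemma exponent_high (c z eta d : R) : 0 <= d -> 16 * d <= eta -> eta <= 1 ->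
  c * (2 - z) = 1 -> z <= 1 -> c <= 1 ->
  - (d * (2 - z) - d ^+ 2) * (c + eta / 2) + (d + 2 * d ^+ 2) <= - (eta * d / 4).
Proof.
move=> d0 de e1 cz z1 c1.
have -> : - (d * (2 - z) - d ^+ 2) * (c + eta / 2) + (d + 2 * d ^+ 2) =
   - d * (c * (2 - z)) - d * eta * (2 - z) / 2 + d ^+ 2 * (c + eta / 2) + d + 2 * d ^+ 2.
  by field.
have h5 : d ^+ 2 * (c + eta / 2) <= d ^+ 2 * 2.
  by rewrite ler_wpM2l ?sqr_ge0//; clear -c1 e1; lra.
have h6 : d * eta * 1 <= d * eta * (2 - z).
  by rewrite ler_wpM2l ?mulr_ge0//; clear -z1 d0 de; lra.
have h7 : d * (16 * d) <= d * eta by rewrite ler_wpM2l.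
rewrite cz [eta * d]mulrC; move: h5 h6 h7; rewrite expr2.
have -> : d * (16 * d) = 16 * (d * d) by ring.
have -> : d * eta * (2 - z) = 2 * (d * eta) - d * eta * z by ring.
move: (d * eta) (d * d) (d * eta * z) (d * d * (_ + _)) => v u t w h5 h6 h7.
clear -h5 h6 h7; lra.
Qed.

(** Removing a left arc of at most a fraction 1/D of the multiplicity spends only half of the
    surplus [eta]. The -1 comes from m = k + 1 and later costs a factor [expR 1]. *)
Lemma tail_ge (c eta : R) (g n k D l : nat) :
  0 < eta -> eta <= 1 -> 0 <= c -> c <= 1 -> 4 <= eta * D%:R ->
  (k <= n + l)%N -> (l * D <= k.+1)%N -> (c + eta) * g%:R <= k.+1%:R ->
  (c + eta / 2) * g%:R - 1 <= n%:R.
Proof.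
move=> eta0 e1 c0 c1 eD nk lD kg.
have lm := frac_le R eta D l k.+1 (ltW eta0) eD lD.
have nk' : k.+1%:R <= n%:R + l%:R + 1 :> R by rewrite -natrD natr1 ler_nat ltnS.
have h1 : (1 - eta / 4) * ((c + eta) * g%:R) <= (1 - eta / 4) * k.+1%:R.
  by rewrite ler_wpM2l//; clear -e1; lra.
have h2 : (c + eta / 2) * g%:R <= (1 - eta / 4) * ((c + eta) * g%:R).
  rewrite mulrA ler_wpM2r//.
  have -> : (1 - eta / 4) * (c + eta) = c + eta - eta * (c + eta) / 4 by field.
  have h3 : eta * (c + eta) <= eta * 2.
    by rewrite ler_wpM2l//; [exact: ltW|clear -e1 c1; lra].
  by clear -h3; lra.
move: h1; rewrite mulrBl mul1r => h1.
clear -nk' lm h1 h2; lra.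
Qed.

Lemma weight_high (a B eta d : R) (g n k D l : nat) :
  0 <= a -> 0 <= B -> 0 <= d -> 16 * d <= eta -> 0 < eta -> eta <= 1 ->
  4 <= eta * D%:R ->
  (k <= n + l)%N -> (l * D <= k.+1)%N -> (gamma R + eta) * g%:R <= k.+1%:R ->
  a * (x * (1 - d)) ^+ g <= B * (x * (1 - d) + (x * (1 - d)) ^+ 2) ^+ n ->
  a * x ^+ g <= B * expR 1 * expR (- (eta * d / 4) * g%:R).
Proof.
move=> a0 B0 d0 de eta0 e1 eD nk lD kg H.
have d1 : d <= 1/16 by clear -de e1; lra.
have d01 : 0 <= d <= 1/2 by apply/andP; split => //; clear -d1; lra.
have /andP[x0 x1] := @gold_bounds R.
have /andP[c0 c1] := @gamma_bounds R.
have xp : 0 < x by clear -x0; lra.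
have xl : x <= 1 by clear -x1; lra.
have cp : 0 <= gamma R by clear -c0; lra.
have cl : gamma R <= 1 by clear -c1; lra.
have y0 : 0 < x * (1 - d) by rewrite mulr_gt0//; clear -d1; lra.
have dm : -1 < - d by clear -d1; lra.
have H1 := le_trans H (ler_wpM2l B0 (pow_expR _ _ n (sum_ge0 (- d) dm) (tilt_sum (- d)))).
have H2 := tilt_le a _ _ _ g a0 y0 (tilt_down d d01) H1.
apply: (le_trans H2) => {H H1 H2}; rewrite -!mulrA -!expRD ler_wpM2l// ler_expR.
have -> : (- d * (2 - x) + (- d) ^+ 2) = - (d * (2 - x) - d ^+ 2) by ring.
have k0 : 0 <= d * (2 - x) - d ^+ 2.
  have -> : d * (2 - x) - d ^+ 2 = d * (2 - x - d) by ring.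
  by rewrite mulr_ge0//; clear -xl d1; lra.
have n_ge := tail_ge (gamma R) eta g n k D l eta0 e1 cp cl eD nk lD kg.
have h1 := ler_wpM2l k0 n_ge.
have h2 : d * (2 - x) - d ^+ 2 <= 1.
  rewrite lerBlDr (@le_trans _ _ 1)// ?lerDl ?sqr_ge0//.
  apply: (@le_trans _ _ (1/16 * 2)); last by clear; lra.
  by rewrite ler_pM//; clear -xl xp; lra.
have h3 := ler_wpM2r (ler0n R g) (exponent_high (gamma R) x eta d d0 de e1 gamma_gold xl cl).
set u := d * (2 - x) - d ^+ 2 in h1 h2 h3 *; clearbody u.
clear -h1 h2 h3; lra.
Qed.

(** A left arc longer than about m / D pays for the upward tilt. It gains 3/1000 on at least (l -
    4)/2 positions, that is 3 l / 2000 up to a constant, while the tail grows by at most 3 d l D <=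
    3 l / 2000; this fixes the 2000. The tilt itself then leaves d^2 - d <= -d/2 per unit of
    genus. *)
Lemma weight_arc (a B d : R) (g n k D l : nat) :
  0 <= a -> 0 <= B -> 0 <= d <= 1/2 -> 2000 * d * D%:R <= 1 ->
  (n <= k)%N -> (k <= l * D)%N ->
  a * (x * (1 + d)) ^+ g <=
    B * (997/1000) ^+ (l - 3)./2 * (x * (1 + d) + (x * (1 + d)) ^+ 2) ^+ n ->
  a * x ^+ g <= B * expR 1 * expR (- (d / 2) * g%:R).
Proof.
move=> a0 B0 d01 dD nk kl H; have /andP[d0 d1] := d01.
have /andP[x0 x1] := @gold_bounds R.
have xp : 0 < x by clear -x0; lra.
have xl : x <= 1 by clear -x1; lra.
have y0 : 0 < x * (1 + d) by rewrite mulr_gt0//; clear -d0; lra.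
have dm : -1 < d by clear -d0; lra.
have mu0 : 0 <= 997/1000 :> R by clear; lra.
have mue : 997/1000 <= expR (- (3/1000)) :> R.
  by apply: le_trans (expR_ge1Dx _); clear; lra.
have M0 : 0 <= B * (997/1000) ^+ (l - 3)./2 by rewrite mulr_ge0// exprn_ge0.
have H1 := le_trans H (ler_wpM2l M0 (pow_expR _ _ n (sum_ge0 d dm) (tilt_sum d))).
have {}H1 := le_trans H1 (ler_wpM2r (expR_ge0 _) (ler_wpM2l B0 (pow_expR _ _ (l - 3)./2 mu0 mue))).
have H2 := tilt_le a _ _ _ g a0 y0 (tilt_up d d01) H1.
apply: (le_trans H2) => {H H1 H2}; rewrite -!mulrA -!expRD ler_wpM2l// ler_expR.
have nl : n%:R <= l%:R * D%:R :> R by rewrite -natrM ler_nat (leq_trans nk).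
have l2 : l%:R - 4 <= 2 * (l - 3)./2%:R :> R.
  by rewrite lerBlDr -natrM -natrD ler_nat; clear; lia.
have c : (d * (2 - x) + d ^+ 2) * n%:R <= 3 * d * (l%:R * D%:R).
  rewrite ler_pM//.
    by rewrite addr_ge0 ?sqr_ge0// mulr_ge0//; clear -xl; lra.
  by rewrite expr2 -mulrDr mulrC ler_wpM2r//; clear -d1 xp; lra.
have c2 : 3 * d * (l%:R * D%:R) <= 3 * (l%:R / 2000).
  have -> : 3 * d * (l%:R * D%:R) = 3 * (l%:R / 2000) * (2000 * d * D%:R) by field.
  by rewrite ler_piMr// !mulr_ge0// invr_ge0.
have c3 : (d ^+ 2 - d) * g%:R <= - (d / 2) * g%:R.
  by rewrite ler_wpM2r// expr2; have := ler_wpM2l d0 d1; clear; lra.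
have l0 : 0 <= l%:R :> R by [].
move: ((_ + _) * n%:R) c => u c.
clear -c c2 c3 l2 l0; lra.
Qed.
End Tilt.

(** * Union bound over the atypical lists *)

Section Atypical.
Context {R : realType}.
Local Notation x := (@gold R).

Definition typical (D : nat) (eta : R) (g : nat) (s : seq nat) : bool :=
  [&& (top s <= 3)%N, (top s == 3) ==> (last_top s * D <= (size s).+1)%N,
      (gamma R - eta) * g%:R < (size s).+1%:R
    & (size s).+1%:R < (gamma R + eta) * g%:R].

Lemma atypical_key_le (D : nat) (eta : R) (g k q l a : nat) (X : seq (seq nat)) :
  0 < eta -> eta <= 1 -> 4 <= eta * D%:R -> (0 < g)%N -> uniq X ->
  (forall s, s \in X -> [/\ s \in kunzs g, ~~ typical D eta g s &
     (size s, top s, last_top s, first1 s) = (k, q, l, a)]) ->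
  (size X)%:R * x ^+ g <=
     25 * expR 1 * expR (- (eta / (2000 * D%:R) / 4) * g%:R).
Proof.
move=> eta0 eta1 etaD g0 uX HX.
have [->|] := eqVneq X [::].
  by rewrite mul0r !mulr_ge0// expR_ge0.
case: X uX HX => // s0 X' uX HX _; set X := s0 :: X' in uX HX *.
have [s0K s0bad [s0k s0q s0l s0a]] := HX s0 (mem_head _ _).
have Hsize s : s \in X -> [/\ kunz s, sumn s = g, size s = k & (0 < k)%N].
  move=> /HX[]; rewrite mem_kunzs => /andP[sK /eqP sg] _ [sk _ _ _]; split=> //.
  by rewrite -sk; move: g0; rewrite -sg; case: (s).
have k0 : (0 < k)%N by have [] := Hsize s0 (mem_head _ _).
have Hkey s : s \in X -> [/\ top s = q, last_top s = l & first1 s = a].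
  by move=> /HX[_ _ [_ ? ? ?]].
have D0 : 0 < D%:R :> R.
  rewrite lt0r ler0n andbT; apply: contraTneq etaD => ->.
  by rewrite mulr0 -ltNge.
have D4 : 4 <= D%:R :> R by apply: (le_trans etaD); rewrite ler_piMl// ltW.
(* The largest tilt allowed by [weight_arc]. Since 4 <= eta * D, it also satisfies 16 d <= eta, as
   [weight_high] demands. *)
pose d : R := (2000 * D%:R)^-1.
have dD : 2000 * d * D%:R = 1 by rewrite /d; field; rewrite gt_eqF.
have d0 : 0 < d by rewrite invr_gt0 mulr_gt0.
have dD' : d * D%:R = 1/2000 by rewrite /d; field; rewrite gt_eqF.
have d8 : d <= 1/8000.
  by have := ler_wpM2l (ltW d0) D4; rewrite dD'; clear; lra.
have d16 : 16 * d <= eta.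
  have := ler_wpM2l (ltW d0) etaD.
  have -> : d * (eta * D%:R) = eta * (d * D%:R) by ring.
  by rewrite dD'; clear -eta0; lra.
have d01 : 0 <= d <= 1/2 by rewrite ltW//=; clear -d8; lra.
have d4 : 4 * d <= eta by clear -d0 d16; lra.
have /andP[x0 x1] := @gold_bounds R.
have xp : 0 < x by clear -x0; lra.
(* Every way of being atypical has its own decay rate; all are at least eta * d / 4, the one of a
   too large multiplicity. *)
have fin (c B : R) : eta * d / 4 <= c -> 0 <= B -> B <= 25 * expR 1 ->
    (size X)%:R * x ^+ g <= B * expR (- c * g%:R) ->
  (size X)%:R * x ^+ g <=
     25 * expR 1 * expR (- (eta / (2000 * D%:R) / 4) * g%:R).
  move=> hc B0 HB H; apply: (le_trans H); rewrite ler_pM ?expR_ge0//.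
  by rewrite ler_expR ler_wpM2r// lerN2.
have e1 : 1 <= expR 1 :> R by rewrite -[leLHS]expR0 ler_expR.
have B25 : 25 <= 25 * expR 1 :> R by rewrite ler_peMr.
have B5e : 5 * expR 1 <= 25 * expR 1 :> R by rewrite ler_wpM2r ?expR_ge0//; clear; lra.
have B5 : 5 <= 25 * expR 1 :> R by apply: le_trans B25; clear; lra.
have B1 : 1 <= 25 * expR 1 :> R by apply: le_trans B25; clear; lra.
have B1e : 1 * expR 1 <= 25 * expR 1 :> R by rewrite ler_wpM2r ?expR_ge0//; clear; lra.
have ed : eta * d <= d by rewrite ler_piMl// ltW.
have ed0 : 0 <= eta * d by rewrite mulr_ge0// ltW.
have cA : eta * d / 4 <= 1/1000 by clear -ed d8; lra.
have cB : eta * d / 4 <= d / 2 by clear -ed d0; lra.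
have cC : eta * d / 4 <= eta * d / 2 by clear -ed0; lra.
have sX0 : 0 <= (size X)%:R :> R by [].
have yup : 0 < x * (1 + d) <= 619/1000.
  rewrite mulr_gt0//=; last by clear -d0; lra.
  apply: (@le_trans _ _ (6181/10000 * (1 + 1/8000))); last by clear; lra.
  by apply: ler_pM; [exact: ltW xp|clear -d0; lra|exact: ltW x1|clear -d8; lra].
have ydown : 0 < x * (1 - d) <= 619/1000.
  rewrite mulr_gt0//=; last by clear -d8; lra.
  apply: (@le_trans _ _ (6181/10000 * 1)); last by clear; lra.
  by apply: ler_pM; [exact: ltW xp|clear -d8; lra|exact: ltW x1|clear -d0; lra].
have [q4|q3] := leqP 4 q.
  have H : (size X)%:R * (619/1000 : R) ^+ g <= 25.
    by apply: (count_top_ge4 R X g k q l a q4 uX) => s sX; split; [exact: Hsize|exact: Hkey].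
  apply: (fin _ 25 cA _ B25); first by clear; lra.
  apply: tilt_le H => //; first by clear; lra.
  (* [gold] < 0.6181 < 0.619 * 0.999, so passing from 619/1000 to [gold] gains at rate 1/1000. *)
  apply: (@le_trans _ _ (619/1000 * (1 - 1/1000))); first by clear -x1; lra.
  by rewrite ler_wpM2l ?expR_ge1Dx//; clear; lra.
have lk : (0 < l <= k)%N by rewrite -s0l -s0k last_top_rng// s0k.
have [qE|q3'] := eqVneq q 3.
  have H (y : R) : 0 < y <= 619/1000 -> (size X)%:R * y ^+ g <=
      5 * (997/1000) ^+ (l - 3)./2 * (y + y ^+ 2) ^+ (k - l).
    move=> hy; apply: (count_top3 R y X g k l a hy uX) => s sX; split; first exact: Hsize.
    by rewrite -qE; exact: Hkey.
  have H' (y : R) : 0 < y <= 619/1000 -> (size X)%:R * y ^+ g <=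
      5 * (y + y ^+ 2) ^+ (k - l).
    move=> hy; apply: (le_trans (H y hy)); have /andP[/ltW hy0 _] := hy.
    rewrite ler_wpM2r ?exprn_ge0 ?addr_ge0 ?exprn_ge0// ler_piMr//.
    by rewrite exprn_ile1//; clear; lra.
  move: s0bad; rewrite /typical s0q s0l s0k qE /= !negb_and -!leNgt -!ltnNge.
  move=> /or3P[kl|mlow|mhigh].
  - apply: (fin _ _ cB _ B5e); first by rewrite mulr_ge0// expR_ge0.
    apply: (weight_arc _ 5 d g (k - l) k D l sX0 _ d01 _ (leq_subr _ _) _ (H _ yup)) => //.
      by rewrite dD.
    exact: ltnW (ltnW kl).
  - apply: (fin _ _ cC _ B5) => //.
    apply: (weight_low _ 5 eta d g (k - l) k sX0 _ d01 d4 (leq_subr _ _) _ (H' _ yup)) => //.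
    by apply: le_trans mlow; rewrite ler_nat.
  - have [lD|kl] := leqP (l * D) k.+1.
      apply: (fin _ _ (lexx _) _ B5e); first by rewrite mulr_ge0// expR_ge0.
      apply: (weight_high _ 5 eta d g (k - l) k D l sX0 _ (ltW d0) d16 eta0 eta1 etaD _ lD mhigh (H' _ ydown)) => //.
      by rewrite subnK//; case/andP: lk.
    apply: (fin _ _ cB _ B5e); first by rewrite mulr_ge0// expR_ge0.
    apply: (weight_arc _ 5 d g (k - l) k D l sX0 _ d01 _ (leq_subr _ _) _ (H _ yup)) => //.
      by rewrite dD.
    exact: ltnW (ltnW kl).
have q2 : (q <= 2)%N by move: q3 q3'; clear; lia.
have H (y : R) : 0 < y <= 619/1000 -> (size X)%:R * y ^+ g <= 1 * (y + y ^+ 2) ^+ k.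
  move=> /andP[/ltW y0 _]; rewrite mul1r; apply: count_top_le2 => // s sX.
  have [sK sg sk _] := Hsize _ sX; split=> //.
  rewrite mem_lists sk eqxx; apply/(all_nthP 0%N) => i; rewrite sk => ik.
  have hi : (0 < i.+1 <= size s)%N by rewrite sk.
  have [K1 _ _] := kunzP _ sK; apply/andP; split; first exact: (K1 i.+1 hi).
  have [tq _ _] := Hkey _ sX.
  by apply: (leq_trans (kz_top _ _ hi)); rewrite tq.
move: s0bad; rewrite /typical s0q s0l s0k.
have -> : (q <= 3)%N by exact: leqW.
rewrite (negbTE q3') /= negb_and -!leNgt => /orP[mlow|mhigh].
- apply: (fin _ _ cC _ B1) => //.
  apply: (weight_low _ 1 eta d g k k sX0 _ d01 d4 _ _ (H _ yup)) => //.
  by apply: le_trans mlow; rewrite ler_nat.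
- apply: (fin _ _ (lexx _) _ B1e); first by rewrite mulr_ge0// expR_ge0.
  apply: (weight_high _ 1 eta d g k k D 0 sX0 _ (ltW d0) d16 eta0 eta1 etaD _ _ mhigh (H _ ydown)) => //.
  by rewrite addn0.
Qed.

Lemma atypical_le (D : nat) (eta : R) (g : nat) :
  0 < eta -> eta <= 1 -> 4 <= eta * D%:R -> (0 < g)%N ->
  (size [seq s <- kunzs g | ~~ typical D eta g s])%:R * x ^+ g <=
  (g.+2 ^ 4)%:R * (25 * expR 1 * expR (- (eta / (2000 * D%:R) / 4) * g%:R)).
Proof.
move=> eta0 eta1 etaD g0; set X := [seq s <- _ | _].
have /andP[x0 _] := @gold_bounds R.
have xg : 0 < x ^+ g by rewrite exprn_gt0//; clear -x0; lra.
set B := 25 * _ * _.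
pose I := iota 0 g.+2.
pose Ks := [seq (u, v) | u <- [seq (u, v) | u <- [seq (u, v) | u <- I, v <- I], v <- I], v <- I].
have szKs : size Ks = (g.+2 ^ 4)%N.
  by rewrite !size_allpairs size_iota !expnS expn0; ring.
rewrite -szKs -ler_pdivlMr// -mulrA.
apply: (@size_le_keys _ _ _ (fun s => (size s, top s, last_top s, first1 s))).
  move=> s; rewrite mem_filter mem_kunzs => /andP[_ /andP[sK /eqP sg]].
  have s_size : (size s <= g)%N.
    by rewrite -sg size_le_sumn//; case/and3P: sK.
  have s_top : (top s <= g)%N.
    rewrite /top; apply/bigmax_leqP_seq => v vs _.
    by rewrite -sg -(nth_index 0%N vs) leq_nth_sumn.
  have s_last : (last_top s <= g)%N by rewrite (leq_trans (leq_subr _ _)).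
  have s_first : (first1 s <= g.+1)%N by rewrite ltnS (leq_trans (index_size _ _)).
  do 3 (apply: allpairs_f; last by rewrite mem_iota add0n !ltnS ?leqW).
  by rewrite mem_iota add0n !ltnS leqW.
move=> [[[k q] l] a] _; rewrite ler_pdivlMr//.
apply: (atypical_key_le D eta g k q l a) => //.
  by do 2 apply: filter_uniq; exact: uniq_kunzs.
by move=> s; rewrite !mem_filter => /and3P[/eqP-> -> ->].
Qed.

(** With t = 1 + c g / 5, the exponential of c g is at least t^5 and g + 2 is at most (2 + 5 / c) t;
    one power of t is left over. *)
Lemma poly_expR (c : R) (g : nat) : 0 < c ->
  (g.+2 ^ 4)%:R * expR (- c * g%:R) <= (2 + 5 / c) ^+ 4 / (1 + c / 5 * g%:R).
Proof.
move=> c0; pose t := 1 + c / 5 * g%:R; rewrite -/t.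
have t0 : 0 < t by rewrite ltr_pwDl// mulr_ge0// divr_ge0// ltW.
have K0 : 0 <= 2 + 5 / c by rewrite addr_ge0// divr_ge0// ltW.
have h1 : t ^+ 5 <= expR (c * g%:R).
  have -> : c * g%:R = 5%:R * (c / 5 * g%:R) by field.
  rewrite expRM_natl lerXn2r ?nnegrE ?expR_ge0 ?(ltW t0)//.
  exact: expR_ge1Dx.
have h2 : g.+2%:R <= (2 + 5 / c) * t.
  have -> : (2 + 5 / c) * t = 2 + g%:R + (5 / c + 2 * (c / 5) * g%:R).
    by rewrite /t; field; rewrite gt_eqF.
  have c5 : 0 <= 5 / c by rewrite divr_ge0// ltW.
  have c5' : 0 <= c / 5 by rewrite divr_ge0// ltW.
  by rewrite -addn2 natrD addrC lerDl addr_ge0// mulr_ge0// mulr_ge0.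
rewrite mulNr expRN ler_pdivrMr ?expR_gt0//.
apply: (@le_trans _ _ ((2 + 5 / c) ^+ 4 * t ^+ 4)).
  by rewrite natrX -exprMn lerXn2r ?nnegrE// mulr_ge0// ltW.
rewrite -[leRHS]mulrA ler_wpM2l ?exprn_ge0//.
apply: (@le_trans _ _ (t^-1 * t ^+ 5)).
  by rewrite [t ^+ 5]exprS mulrA mulVf ?mul1r// gt_eqF.
by rewrite ler_wpM2l// invr_ge0 ltW.
Qed.

Lemma atypical_small (D : nat) (eta e : R) : 0 < eta -> eta <= 1 -> 4 <= eta * D%:R ->
  0 < e -> exists M : R, forall g : nat, M < g%:R ->
  (size [seq s <- kunzs g | ~~ typical D eta g s])%:R <= e * (size (kunzs g))%:R.
Proof.
move=> eta0 eta1 etaD e0.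
have /andP[x0 x1] := @gold_bounds R.
have xp : 0 < x by clear -x0; lra.
have D0 : 0 < D%:R :> R.
  rewrite lt0r ler0n andbT; apply: contraTneq etaD => ->.
  by rewrite mulr0 -ltNge.
pose c := eta / (2000 * D%:R) / 4.
have c0 : 0 < c by rewrite /c !divr_gt0// mulr_gt0.
pose K := 25 * expR 1 * (2 + 5 / c) ^+ 4.
have c5 : 0 <= 2 + 5 / c by rewrite addr_ge0// divr_ge0// ltW.
have K0 : 0 <= K by rewrite /K !mulr_ge0 ?expR_ge0// exprn_ge0.
exists (Num.max 1 (5 / c * (K / (e * x)))) => g; rewrite gt_max => /andP[g1 gM].
have g0 : (0 < g)%N by rewrite -(ltr_nat R) (lt_trans ltr01).
have xg : 0 < x ^+ g by rewrite exprn_gt0.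
rewrite -(ler_pM2r xg) -mulrA.
apply: (le_trans (atypical_le D eta g eta0 eta1 etaD g0)).
apply: (@le_trans _ _ (e * x)); last by rewrite ler_wpM2l ?size_kunzs_ge// ltW.
rewrite mulrCA -/c.
apply: (@le_trans _ _ (25 * expR 1 * ((2 + 5 / c) ^+ 4 / (1 + c / 5 * g%:R)))).
  by rewrite ler_wpM2l ?mulr_ge0 ?expR_ge0//; exact: poly_expR.
have t0 : 0 < 1 + c / 5 * g%:R by rewrite ltr_pwDl// mulr_ge0// divr_ge0// ltW.
have ex0 : 0 < e * x by exact: mulr_gt0.
have c50 : 0 < c / 5 by exact: divr_gt0.
rewrite mulrA -/K ler_pdivrMr// mulrC -ler_pdivrMr//.
apply: (@le_trans _ _ (c / 5 * g%:R)); last by rewrite lerDr.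
rewrite -ler_pdivrMl//.
by rewrite invf_div ltW.
Qed.
End Atypical.

(** * The semigroup with given Kunz coordinates *)

(** The least element congruent to i is k_i m + i. Residue 0 needs its own clause, as [kz s 0] would
    read k_1. *)
Definition sgp (s : seq nat) : set nat :=
  [set n | (n %% (size s).+1 == 0)%N \/
           (kz s (n %% (size s).+1) <= n %/ (size s).+1)%N].

Lemma sgpE s q i : (i < (size s).+1)%N ->
  sgp s (q * (size s).+1 + i)%N <-> (i == 0%N) \/ (kz s i <= q)%N.
Proof. by move=> im; rewrite /sgp /= modnMDl modn_small// divnMDl// divn_small// addn0. Qed.

Lemma sgp_gap s n : kunz s -> (0 < n < (size s).+1)%N -> ~ sgp s n.
Proof.
move=> /kunzP[K1 _ _] /andP[n0 nm].
rewrite -[n]add0n -(mul0n (size s).+1) sgpE// => -[/eqP n0'|].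
  by rewrite n0' in n0.
by rewrite leqNgt K1// n0.
Qed.

Lemma sgp_mult s : sgp s (size s).+1.
Proof. by left; rewrite modnn. Qed.

Lemma sgpD s a b : kunz s -> sgp s a -> sgp s b -> sgp s (a + b)%N.
Proof.
move=> /kunzP[K1 K2 K3]; set m := (size s).+1.
rewrite (divn_eq a m) (divn_eq b m).
have ia : (a %% m < m)%N by rewrite ltn_mod.
have ib : (b %% m < m)%N by rewrite ltn_mod.
move: (a %/ m)%N (a %% m)%N (b %/ m)%N (b %% m)%N ia ib => qa i qb j im jm.
have e : (qa * m + i + (qb * m + j) = (qa + qb) * m + (i + j))%N by lia.
rewrite e => /(sgpE _ _ _ im) Hi /(sgpE _ _ _ jm) Hj.
have [/eqP i0|i0] := boolP (i == 0%N).
  rewrite i0 add0n; apply/sgpE => //.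
  by case: Hj => [|h]; [left|right; lia].
have [/eqP j0|j0] := boolP (j == 0%N).
  rewrite j0 addn0; apply/sgpE => //.
  by case: Hi => [|h]; [left|right; lia].
have {}Hi : (kz s i <= qa)%N by case: Hi => // h; rewrite h in i0.
have {}Hj : (kz s j <= qb)%N by case: Hj => // h; rewrite h in j0.
have [ijm|ijm|ijm] := ltngtP (i + j)%N m.
- by apply/sgpE => //; right; have := K2 i j; rewrite /m in ijm; lia.
- have -> : ((qa + qb) * m + (i + j) = (qa + qb).+1 * m + (i + j - m))%N by lia.
  apply/sgpE; first by rewrite -/m; lia.
  by right; have := K3 i j; rewrite /m in im jm ijm *; lia.
- have -> : ((qa + qb) * m + (i + j) = (qa + qb).+1 * m + 0)%N by lia.
  by apply/sgpE => //; left.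
Qed.

Lemma card_fset_set_seq (T : choiceType) (L : seq T) (A : set T) :
  uniq L -> (forall x, A x <-> x \in L) -> #|` fset_set A|%fset = size L.
Proof.
move=> uL AL; have fA : finite_set A.
  have -> : A = [set` L] by apply/seteqP; split=> x /AL.
  exact: finite_seq.
have -> : fset_set A = seq_fset tt L.
  by apply/fsetP => x; rewrite in_fset_set// seq_fsetE; apply/idP/idP; rewrite inE => /AL.
by rewrite size_seq_fset undup_id.
Qed.

Lemma sgp_gaps s n : ~ sgp s n <->
  n \in [seq (i + j * (size s).+1)%N | i <- iota 1 (size s), j <- iota 0 (kz s i)].
Proof.
set m := (size s).+1; split=> [Sn|/allpairsPdep[i [j [+ + ->]]]]; last first.
  rewrite !mem_iota => hi hj; rewrite addnC sgpE; last lia.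
  by case; lia.
have im : (n %% m < m)%N by rewrite ltn_mod.
apply/allpairsPdep; exists (n %% m)%N, (n %/ m)%N.
rewrite !mem_iota; split; last by rewrite addnC -divn_eq.
- rewrite add1n im andbT lt0n; apply/negP => h; apply: Sn; left; exact: h.
- rewrite add0n ltnNge; apply/negP => h; apply: Sn; right; exact: h.
Qed.

Lemma sgp_numsgps s : kunz s -> numsgps (sumn s) (sgp s).
Proof.
move=> sK; set m := (size s).+1.
pose G := [seq (i + j * m)%N | i <- iota 1 (size s), j <- iota 0 (kz s i)].
have uG : uniq G.
  apply: allpairs_uniq_dep; [exact: iota_uniq|by move=> i _; exact: iota_uniq|].
  move=> _ _ /allpairsPdep[i [j [+ _ ->]]] /allpairsPdep[i' [j' [+ _ ->]]] /=.
  rewrite !mem_iota => hi hi' e.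
  have ei : i = i'.
    have := congr1 (modn^~ m) e.
    by rewrite ![(_ + _ * m)%N]addnC !modnMDl !modn_small// /m; lia.
  have ej : j = j' by move: e; rewrite ei => /addnI/eqP; rewrite eqn_pmul2r// => /eqP.
  by rewrite ei ej.
have hG n : (~` sgp s) n <-> n \in G by exact: sgp_gaps.
split; first split; first by left.
  split=> [a b|]; first exact: sgpD.
  have -> : ~` sgp s = [set` G] by apply/seteqP; split=> n /hG.
  exact: finite_seq.
rewrite /genus (card_fset_set_seq _ G)// size_allpairs_dep.
congr sumn; apply: (@eq_from_nth _ 0%N); rewrite size_map size_iota// => i im.
by rewrite (nth_map 0%N) ?size_iota// nth_iota.
Qed.

(** The multiplicity is recovered as the least positive element, then each coordinate as a threshold
    on the quotient. *)
Lemma sgp_inj s s' : kunz s -> kunz s' -> sgp s = sgp s' -> s = s'.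
Proof.
move=> sK sK' e.
have ss : size s = size s'.
  apply/eqP; rewrite eqn_leq; apply/andP; split; rewrite leqNgt; apply/negP => h.
  - have := sgp_mult s'; rewrite -e; apply: sgp_gap => //.
  - have := sgp_mult s; rewrite e; apply: sgp_gap => //.
apply: (@eq_from_nth _ 0%N) => // i im.
have H q : (kz s i.+1 <= q)%N <-> (kz s' i.+1 <= q)%N.
  have h : (i.+1 < (size s).+1)%N by [].
  have h' : (i.+1 < (size s').+1)%N by rewrite -ss.
  have /iffLR h1 := sgpE s q i.+1 h; have /iffRL h2 := sgpE s q i.+1 h.
  have /iffLR h1' := sgpE s' q i.+1 h'; have /iffRL h2' := sgpE s' q i.+1 h'.
  rewrite e ss in h1 h2; split=> hq.
  - by have [] := h1' (h2 (or_intror hq)).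
  - by have [] := h1 (h2' (or_intror hq)).
apply/eqP; rewrite -[nth 0 s i]/(kz s i.+1) -[nth 0 s' i]/(kz s' i.+1) eqn_leq.
by apply/andP; split; apply/H.
Qed.

(** [m] is the least positive element of [S], and k_i the least k with k m + i in [S]; minimality
    turns closure under addition into the Kunz inequalities. *)
Lemma sgp_surj g S : numsgps g S -> exists2 s, kunz s && (sumn s == g) & sgp s = S.
Proof.
move=> [[S0 [SD Sfin]] Sg].
have [N SN] : exists N, forall n, (N <= n)%N -> S n.
  exists (\max_(n <- fset_set (~` S)) n).+1 => n Nn; apply: contrapT => nS.
  have : n \in fset_set (~` S) by rewrite in_fset_set// inE.
  by move=> /(@leq_bigmax_seq _ _ xpredT id)/(_ isT); rewrite leqNgt Nn.
have ex_m : exists n, (0 < n)%N && `[< S n >].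
  by exists N.+1; apply/asboolP/SN.
have [m /andP[m0 /asboolP Sm] m_min] := ex_minnP ex_m.
have Smul q : S (q * m)%N.
  by elim: q => [|q IHq]; rewrite ?mul0n// mulSn; exact: SD.
have ex_k i : exists k, `[< S (k * m + i)%N >].
  by exists N; apply/asboolP/SN; rewrite (leq_trans (leq_pmulr N m0))// leq_addr.
pose kk i := ex_minn (ex_k i).
have kkS i : S (kk i * m + i)%N by rewrite /kk; case: ex_minnP => k /asboolP.
have kk_min i k : S (k * m + i)%N -> (kk i <= k)%N.
  by rewrite /kk; case: ex_minnP => k' _ H /asboolP; exact: H.
pose s := [seq kk i | i <- iota 1 m.-1].
have szs : size s = m.-1 by rewrite size_map size_iota.
have szs1 : (size s).+1 = m by rewrite szs prednK.
have kzs i : (0 < i <= size s)%N -> kz s i = kk i.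
  move=> hi; rewrite /kz (nth_map 0%N) ?size_iota; last by rewrite -szs; lia.
  by rewrite nth_iota; [congr kk|rewrite -szs]; lia.
have sE : sgp s = S.
  have key n : sgp s n <-> (n %% m == 0)%N \/ (kz s (n %% m) <= n %/ m)%N.
    by rewrite -szs1.
  apply/seteqP; split=> n; last first.
    move=> Sn; apply/key; have [i0|i0] := boolP (n %% m == 0)%N; first by left.
    right; rewrite kzs; last by rewrite lt0n i0 -ltnS szs1 ltn_mod.
    by apply: kk_min; rewrite -divn_eq.
  move=> /key h; rewrite (divn_eq n m).
  have [/eqP ->|i0] := boolP (n %% m == 0)%N; first by rewrite addn0.
  case: h => [h|]; first by rewrite h in i0.
  rewrite kzs; last by rewrite lt0n i0 -ltnS szs1 ltn_mod.
  move=> kq; have -> : (n %/ m * m + n %% m =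
    (n %/ m - kk (n %% m)) * m + (kk (n %% m) * m + n %% m))%N.
    by rewrite addnA -mulnDl subnK.
  exact: SD.
have sK : kunz s.
  apply/kunzP; split=> [i hi|i j i0 j0 ij|i j im jm ij].
  - rewrite kzs// lt0n; apply/negP => /eqP k0.
    have := kkS i; rewrite k0 mul0n add0n => Si.
    have := m_min i; rewrite (_ : (0 < i)%N && `[< S i >]); last first.
      by apply/andP; split; [case/andP: hi|exact/asboolP].
    by move=> /(_ isT); lia.
  - rewrite !kzs; [|lia..].
    by apply: kk_min; rewrite mulnDl addnACA; apply: SD.
  - rewrite !kzs; [|lia..].
    apply: kk_min; rewrite szs1.
    have -> : ((kk i + kk j).+1 * m + (i + j - m) = (kk i * m + i) + (kk j * m + j))%N.
      by rewrite mulSn mulnDl; lia.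
    exact: SD.
exists s => //; rewrite sK -Sg -sE.
by have [_ ->] := sgp_numsgps s sK; rewrite eqxx.
Qed.

Lemma Pg_kunzs (R : realType) g (E : set (set nat)) :
  Pg R g E = (size [seq s <- kunzs g | `[< E (sgp s) >]])%:R / (size (kunzs g))%:R.
Proof.
have injK : {in kunzs g &, injective sgp}.
  by move=> s s'; rewrite !mem_kunzs => /andP[sK _] /andP[sK' _]; exact: sgp_inj.
have nK S : numsgps g S <-> S \in map sgp (kunzs g).
  split=> [/sgp_surj[s sK <-]|/mapP[s + ->]].
    by apply: map_f; rewrite mem_kunzs.
  by rewrite mem_kunzs => /andP[sK /eqP <-]; exact: sgp_numsgps.
have uK := uniq_kunzs g.
rewrite /Pg; congr (_%:R / _%:R).
  rewrite (card_fset_set_seq _ (map sgp [seq s <- kunzs g | `[< E (sgp s) >]])) ?size_map//.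
    rewrite map_inj_in_uniq; first by apply: filter_uniq.
    by move=> s s'; rewrite mem_filter => /andP[_ h]; rewrite mem_filter => /andP[_ h']; exact: injK.
  move=> S; split=> [[/nK/mapP[s sK ->] ES]|/mapP[s + ->]].
    by apply: map_f; rewrite mem_filter sK andbT; exact/asboolP.
  rewrite mem_filter => /andP[/asboolP ES sK]; split=> //.
  by apply/nK; exact: map_f.
by rewrite (card_fset_set_seq _ (map sgp (kunzs g))) ?size_map// map_inj_in_uniq.
Qed.

(** * Resampling the tail *)

Definition tail_ok (p1 p2 : pred nat) (t : seq nat) : bool :=
  all (fun i => (p1 i ==> (nth 0 t i == 1)) && (p2 i ==> (nth 0 t i == 2)))%N
      (iota 0 (size t)).

Lemma iota_rcons n : iota 0 n.+1 = iota 0 n ++ [:: n].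
Proof. by rewrite -addn1 iotaD. Qed.

Lemma tail_ok_rcons p1 p2 t v : tail_ok p1 p2 (rcons t v) =
  [&& tail_ok p1 p2 t, p1 (size t) ==> (v == 1)%N & p2 (size t) ==> (v == 2)%N].
Proof.
rewrite /tail_ok size_rcons iota_rcons all_cat /= andbT nth_rcons ltnn eqxx.
congr (_ && _); apply: eq_in_all => i; rewrite mem_iota add0n => /andP[_ it].
by rewrite nth_rcons it.
Qed.

Lemma count_lists2S (P : pred (seq nat)) n :
  count P (lists 2 n.+1) =
  (count (fun t => P (rcons t 1%N)) (lists 2 n) +
   count (fun t => P (rcons t 2)) (lists 2 n))%N.
Proof.
rewrite [lists 2 n.+1](_ : _ = [seq rcons s v | s <- lists 2 n, v <- iota 1 2])//.
by elim: (lists 2 n) => //= s L ->; lia.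
Qed.

Lemma count_in0 (T : eqType) (P : pred T) (L : seq T) :
  (forall t, t \in L -> ~~ P t) -> count P L = 0%N.
Proof.
by move=> PL; apply/eqP; rewrite -leqn0 leqNgt -has_count; apply/hasPn.
Qed.

(** For a list over {1, 2} of length [n] the excess [r] of the sum over [n] is the number of entries
    2. Positions in [p1] and [p2] are forced to be 1 and 2. *)
Definition tail_count (p1 p2 : pred nat) (n r : nat) : nat :=
  count (fun t => (sumn t == n + r) && tail_ok p1 p2 t)%N (lists 2 n).

Lemma tail_countS p1 p2 n r : tail_count p1 p2 n.+1 r =
  ((if p2 n then 0 else tail_count p1 p2 n r) +
   (if p1 n then 0 else if r is r'.+1 then tail_count p1 p2 n r' else 0))%N.
Proof.
have szl t : t \in lists 2 n -> size t = n /\ (n <= sumn t)%N.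
  rewrite mem_lists => /andP[/eqP sz /allP h]; split=> //; rewrite -sz.
  by apply: size_le_sumn; apply/allP => v /h /andP[].
rewrite /tail_count count_lists2S; congr (_ + _)%N.
  case: ifPn => p2n.
    apply: count_in0 => t /szl[tn _].
    by rewrite tail_ok_rcons tn p2n /= !andbF.
  apply: eq_in_count => t /szl[tn _]; rewrite tail_ok_rcons tn (negbTE p2n) /=.
  by rewrite sumn_rcons implybT !andbT; congr (_ && _); lia.
case: ifPn => p1n.
  apply: count_in0 => t /szl[tn _].
  by rewrite tail_ok_rcons tn p1n /= !andbF.
case: r => [|r].
  apply: count_in0 => t /szl[tn nt].
  rewrite sumn_rcons; apply/negP => /andP[/eqP h _]; lia.
apply: eq_in_count => t /szl[tn _]; rewrite tail_ok_rcons tn (negbTE p1n) /=.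
by rewrite sumn_rcons implybT !andbT; congr (_ && _); lia.
Qed.

(** Outside the forced positions the remaining entries 2 are placed freely; at a free last position
    the recursion is Pascal's rule. *)
Lemma tail_countE (p1 p2 : pred nat) (n r : nat) : (forall i, p1 i -> ~~ p2 i) ->
  let j1 := count p1 (iota 0 n) in let j2 := count p2 (iota 0 n) in
  [/\ (j1 + j2 <= n)%N, (r < j2)%N -> tail_count p1 p2 n r = 0%N
    & tail_count p1 p2 n (j2 + r) = 'C(n - j1 - j2, r)].
Proof.
move=> p12; elim: n r => [|n IHn] r.
  split=> //=; rewrite /tail_count /= add0n.
  by case: r => [|r]; rewrite ?bin0.
rewrite iota_rcons !count_cat /= !addn0.
set j1 := count p1 _; set j2 := count p2 _.
have IH r' : [/\ (j1 + j2 <= n)%N, (r' < j2)%N -> tail_count p1 p2 n r' = 0%N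
    & tail_count p1 p2 n (j2 + r') = 'C(n - j1 - j2, r')] := IHn r'.
have [jn _ _] := IH 0%N.
case: (boolP (p1 n)) => p1n; case: (boolP (p2 n)) => p2n.
- by move: (p12 _ p1n); rewrite p2n.
- rewrite !tail_countS (negbTE p2n) p1n /= !addn0 addn1; split; first lia.
    by have [] := IH r.
  by have -> : (n.+1 - j1.+1 - j2 = n - j1 - j2)%N; [lia|have [] := IH r].
- rewrite !tail_countS p2n (negbTE p1n) /= !addn0 addn1 !add0n; split; first lia.
    by case: r => // r; rewrite ltnS; have [] := IH r.
  by have -> : (n.+1 - j1 - j2.+1 = n - j1 - j2)%N; [lia|have [] := IH r].
- rewrite !tail_countS (negbTE p2n) (negbTE p1n) /= !addn0; split; first lia.
    case: r => [|r] rj; first by rewrite addn0; have [_ ->] := IH 0%N.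
    have [_ H1 _] := IH r.+1; have [_ H2 _] := IH r.
    by rewrite H1// H2// ltnW.
  have -> : (n.+1 - j1 - j2 = (n - j1 - j2).+1)%N by lia.
  case: r => [|r].
    rewrite addn0 bin0; have [_ _] := IH 0%N; rewrite addn0 bin0 => ->.
    case: (j2) (IH) => // j IH'; have [_ -> // _] := IH' j.
  by rewrite addnS binS -addnS; have [_ _ ->] := IH r.+1; have [_ _ ->] := IH r.
Qed.

(** Draws without replacement. Each prescribed entry multiplies the binomial coefficient by a ratio
    (r - j) / (n - i) or its complement, within [tau] of [z] or 1 - z; as all partial products are
    at most 1, the errors add up. *)
Lemma binom_ratio (R : realFieldType) (z tau : R) (n r l1 l2 l : nat) :
  0 <= z <= 1 -> 0 <= tau -> (l1 + l2 <= l)%N -> (l <= n)%N -> (l2 <= r)%N ->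
  (forall i j, (j <= l2)%N -> (i < l)%N ->
     `|(r - j)%:R - z * (n - i)%:R| <= tau * (n - i)%:R :> R) ->
  ('C(n - l1 - l2, r - l2) <= 'C(n, r))%N /\
  `|'C(n - l1 - l2, r - l2)%:R - (1 - z) ^+ l1 * z ^+ l2 * 'C(n, r)%:R|
     <= (l1 + l2)%:R * tau * 'C(n, r)%:R.
Proof.
move=> /andP[z0 z1] t0 + ln + H.
have step (w : R) (b b' B q : R) (k : nat) (N M : nat) : 0 <= w <= 1 -> 0 <= B ->
    (0 < N)%N -> N%:R * b' = M%:R * b -> `|M%:R - w * N%:R| <= tau * N%:R ->
    0 <= b -> b <= B -> `|b - q * B| <= k%:R * tau * B ->
    `|b' - q * w * B| <= k.+1%:R * tau * B.
  move=> /andP[w0 w1] B0 N0 e hM b0 bB hb.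
  have NR : 0 < N%:R :> R by rewrite ltr0n.
  have -> : b' - q * w * B = (M%:R - w * N%:R) / N%:R * b + w * (b - q * B).
    have -> : b' = M%:R * b / N%:R by rewrite -e mulrC mulKf// gt_eqF.
    by field; rewrite gt_eqF.
  apply: (le_trans (ler_normD _ _)).
  have -> : k.+1%:R * tau * B = tau * B + k%:R * tau * B by rewrite -natr1; ring.
  rewrite lerD//; last by rewrite normrM ger0_norm// (le_trans _ hb)// ler_piMl.
  rewrite !normrM normfV (gtr0_norm NR) (ger0_norm b0) ler_pM//.
    by rewrite ?mulr_ge0 ?invr_ge0.
  by rewrite ler_pdivrMr.
elim: l2 H => [|l2 IH2] H.
  rewrite addn0 subn0 => + _; elim: l1 => [|l1 IH1] l1l.
    by split; rewrite ?subn0// !expr0 !mul1r subrr normr0 mul0r mul0r.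
  have [I1 I2] := IH1 (ltnW l1l).
  have nl1 : (0 < n - l1)%N by rewrite subn_gt0 (leq_trans l1l).
  have e : ((n - l1) * 'C(n - l1.+1, r) = (n - l1 - r) * 'C(n - l1, r))%N.
    by rewrite subnS mul_bin_down.
  rewrite !subn0 in I1 I2 *; split.
    rewrite (leq_trans _ I1)// -(leq_pmul2l nl1) e leq_mul2r leq_subr orbT//.
  rewrite !expr0 !mulr1 in I2 *.
  have [rn|nr] := leqP r (n - l1).
    rewrite exprSr; apply: (step (1 - z) 'C(n - l1, r)%:R _ _ _ _ (n - l1)%N (n - l1 - r)%N) => //.
    - by rewrite subr_ge0 z1 lerBlDr lerDl.
    - by rewrite -!natrM e.
    - have := H l1 0%N (leqnn _) l1l; rewrite subn0 => h.
      have -> : (n - l1 - r)%:R - (1 - z) * (n - l1)%:R = - (r%:R - z * (n - l1)%:R).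
        by rewrite (natrB _ rn); ring.
      by rewrite normrN.
    - by rewrite ler_nat.
  (* Here truncated subtraction spoils the ratio, but both binomials vanish and the induction
     hypothesis already bounds the product. *)
  have b0 : 'C(n - l1, r) = 0%N by rewrite bin_small.
  have b0' : 'C(n - l1.+1, r) = 0%N by rewrite bin_small// (leq_ltn_trans _ nr)// leq_sub2l.
  rewrite b0 b0' in I2 *.
  rewrite !sub0r !normrN in I2 *.
  rewrite exprSr mulrAC normrM (@ger0_norm _ (1 - z)) ?subr_ge0//.
  rewrite (@le_trans _ _ (l1%:R * tau * 'C(n, r)%:R))//.
    by rewrite (le_trans _ I2)// ler_piMr// lerBlDr lerDl.
  by rewrite ler_wpM2r// ler_wpM2r// ler_nat.
move=> l12 l2r.
have [|||I1 I2] := IH2; [by move=> i j jl; apply: H; exact: leqW|lia|lia|].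
have nl : (0 < n - l1 - l2)%N by lia.
have e : ((n - l1 - l2) * 'C(n - l1 - l2.+1, r - l2.+1) =
    (r - l2) * 'C(n - l1 - l2, r - l2))%N.
  have -> : (r - l2 = (r - l2.+1).+1)%N by lia.
  by rewrite subnS mul_bin_diag.
have [rn|nr] := leqP (r - l2) (n - l1 - l2).
  split.
    rewrite (leq_trans _ I1)// -(leq_pmul2l nl) e leq_mul2r rn orbT//.
  rewrite exprSr mulrA addnS.
  apply: (step z 'C(n - l1 - l2, r - l2)%:R _ _ _ _ (n - l1 - l2)%N (r - l2)%N) => //.
  - by rewrite z0 z1.
  - by rewrite -!natrM e.
  - have := H (l1 + l2)%N l2 (leqnSn _) ltac:(lia); by rewrite subnDA.
  - by rewrite ler_nat.
have b0 : 'C(n - l1 - l2, r - l2) = 0%N by rewrite bin_small.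
have b0' : 'C(n - l1 - l2.+1, r - l2.+1) = 0%N by rewrite bin_small//; lia.
rewrite b0 b0' in I1 I2 *; split=> //.
rewrite !sub0r !normrN in I2 *.
rewrite exprSr mulrA mulrAC normrM (@ger0_norm _ z)//.
rewrite (@le_trans _ _ ((l1 + l2)%:R * tau * 'C(n, r)%:R))//.
  by rewrite (le_trans _ I2)// ler_piMr.
by rewrite addnS ler_wpM2r// ler_wpM2r// ler_nat.
Qed.

Lemma group_bound (R : realFieldType) (S T : eqType) (X : seq S) (f : S -> T)
    (F : S -> R) (tau : R) :
  (forall s0, s0 \in X -> `|\sum_(s <- X | f s == f s0) F s| <=
     tau * (count (fun s => f s == f s0) X)%:R) ->
  `|\sum_(s <- X) F s| <= tau * (size X)%:R.
Proof.
move=> H; pose K := undup (map f X).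
have split_sum (G : S -> R) :
    \sum_(s <- X) G s = \sum_(c <- K) \sum_(s <- X | f s == c) G s.
  under [RHS]eq_bigr do rewrite big_mkcond.
  rewrite exchange_big /= big_seq [RHS]big_seq; apply: eq_bigr => s sX.
  have fK : f s \in K by rewrite mem_undup map_f.
  rewrite (bigD1_seq (f s)) ?undup_uniq//= eqxx big1 ?addr0// => c.
  by rewrite eq_sym => /negbTE ->.
rewrite split_sum (le_trans (ler_norm_sum _ _ _))//.
have -> : tau * (size X)%:R = \sum_(c <- K) tau * (count (fun s => f s == c) X)%:R.
  rewrite -mulr_sumr; congr (_ * _).
  rewrite -sum1_size natr_sum split_sum; apply: eq_bigr => c _.
  by rewrite -sum1_count natr_sum.
rewrite big_seq [leRHS]big_seq; apply: ler_sum => c.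
by rewrite mem_undup => /mapP[s sX ->]; exact: H.
Qed.

(** * Classes of lists with a common size and initial segment *)

Section FreeTail.
Context {R : realType}.
Local Notation x := (@gold R).

Definition bottom (D : nat) (s : seq nat) : nat := ((size s).+1 %/ D)%N.

(** The consequence of [typical] that separates the initial segment from the tail; it visibly
    survives replacing the tail by another list over {1, 2} of the same length. *)
Definition free_tail (D : nat) (eta : R) (g : nat) (s : seq nat) : bool :=
  [&& (gamma R - eta) * g%:R < (size s).+1%:R < (gamma R + eta) * g%:R,
      all (fun v => v <= 3)%N s & all (fun v => v <= 2)%N (drop (bottom D s) s)].

Lemma typical_free_tail D eta g s : (0 < D)%N -> typical D eta g s -> free_tail D eta g s.
Proof.
move=> D0 /and4P[t3 tl m1 m2]; apply/and3P; split; first by rewrite m1.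
  apply/(all_nthP 0%N) => i im; apply: leq_trans t3.
  exact: (kz_top s i.+1).
apply/(all_nthP 0%N) => i; rewrite size_drop nth_drop => im.
set j := (bottom D s + i)%N; have js : (j < size s)%N by rewrite /j; lia.
have := kz_top s j.+1 js; rewrite /kz /=.
have [t2|t2] := leqP (top s) 2; first by move=> /leq_trans; apply.
have tE : top s = 3 by apply/eqP; rewrite eqn_leq t3.
move=> _; have := kz_gt_last_top s j.+1; rewrite tE; apply.
rewrite js andbT ltnS (leq_trans _ (leq_addr _ _))//.
by move: tl; rewrite tE eqxx /= /bottom leq_divRL.
Qed.

Definition class_key D (s : seq nat) := (size s, take (bottom D s) s).

(* The coordinates are at most 3, so a tail with entries in {1, 2} satisfies the
   Kunz inequalities automatically: 2 <= 1 + 1 and 3 <= 1 + 1 + 1. *)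
Lemma kunz_cat_tail D eta g s0 t : kunz s0 -> free_tail D eta g s0 ->
  t \in lists 2 (size s0 - bottom D s0) -> kunz (take (bottom D s0) s0 ++ t).
Proof.
move=> /kunzP[K1 K2 K3] /and3P[_ /(all_nthP 0%N) s3 _].
set e := bottom D s0; set u := take e s0; set n := (size s0 - e)%N.
rewrite mem_lists => /andP[/eqP tn /(all_nthP 0%N) t12].
have [es|se] := leqP (size s0) e.
  have t0 : t = [::] by apply: size0nil; rewrite tn /n; lia.
  by rewrite t0 cats0 /u take_oversize//; apply/kunzP; split.
have su : size u = e by rewrite size_takel// ltnW.
set s := u ++ t.
have ss : size s = size s0 by rewrite size_cat su tn /n; lia.
have low i : (0 < i <= e)%N -> kz s i = kz s0 i.
  move=> hi; rewrite /kz nth_cat su.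
  have -> : (i.-1 < e)%N by lia.
  by rewrite nth_take//; lia.
have high i : (e < i <= size s0)%N -> (0 < kz s i <= 2)%N.
  move=> hi; rewrite /kz nth_cat su.
  have -> : (i.-1 < e)%N = false by lia.
  by apply: t12; rewrite tn /n; lia.
have pos i : (0 < i <= size s0)%N -> (0 < kz s i <= 3)%N.
  move=> hi; have [ie|ei] := leqP i e.
    rewrite low ?K1//; last by case/andP: hi => ->.
    by apply: s3; lia.
  by have := high i ltac:(lia); lia.
apply/kunzP; rewrite ss; split=> [i /pos /andP[]//|i j i0 j0 ij|i j im jm ij].
- have [ije|eij] := leqP (i + j) e.
    by rewrite !low; [exact: K2|lia..].
  have := high (i + j)%N; have := pos i; have := pos j; lia.
- have := pos (i + j - (size s0).+1)%N; have := pos i; have := pos j; lia.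
Qed.

(** Members of a class share size, hence [bottom], and initial segment. By [kunz_cat_tail] every
    tail over {1, 2} with the right sum occurs, so within a class the tail is uniform. *)
Lemma class_perm D eta g s0 : s0 \in kunzs g -> free_tail D eta g s0 ->
  perm_eq [seq s <- [seq s <- kunzs g | free_tail D eta g s] | class_key D s == class_key D s0]
          [seq take (bottom D s0) s0 ++ t | t <- [seq t <- lists 2 (size s0 - bottom D s0) |
               sumn t == (g - sumn (take (bottom D s0) s0))%N]].
Proof.
rewrite mem_kunzs => /andP[s0K /eqP s0g] s0D.
set e := bottom D s0; set u := take e s0; set n := (size s0 - e)%N.
have eS : (e <= size s0)%N -> size u = e by move=> ?; rewrite size_takel.
have s0u : (sumn u <= g)%N by rewrite -s0g -[X in (_ <= sumn X)%N](cat_take_drop e s0) sumn_cat leq_addr.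
apply: uniq_perm.
- by do 2 apply: filter_uniq; exact: uniq_kunzs.
- rewrite map_inj_uniq; first by apply: filter_uniq; exact: uniq_lists.
  by move=> t t' /eqP; rewrite eqseq_cat// eqxx => /eqP.
move=> s; apply/idP/mapP => [|[t + ->]].
  rewrite mem_filter => /andP[/eqP[ss su]]; rewrite mem_filter mem_kunzs.
  move=> /andP[sD /andP[sK /eqP sg]].
  have se : bottom D s = e by rewrite /bottom ss.
  rewrite se in su; rewrite -/e in su.
  exists (drop e s); last by rewrite /u -su cat_take_drop.
  rewrite mem_filter; apply/andP; split.
    by rewrite -sg -[X in (_ == sumn X - _)%N](cat_take_drop e s) sumn_cat su addKn.
  rewrite mem_lists size_drop ss eqxx /=.
  case/and3P: sK => s1 _ _; case/and3P: sD => _ _; rewrite se => s2.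
  apply/allP => v vs; rewrite (allP s2 v vs) andbT.
  exact: (allP s1 v (mem_drop vs)).
rewrite mem_filter => /andP[/eqP tg tl].
have tn : size t = n by move: tl; rewrite mem_lists => /andP[/eqP].
have t2 : all (fun v => v <= 2)%N t.
  move: tl; rewrite mem_lists => /andP[_ h].
  by apply/allP => v /(allP h) /andP[].
have stK := kunz_cat_tail D eta g s0 t s0K s0D tl.
rewrite -/e -/u in stK.
have sz : size (u ++ t) = size s0.
  rewrite size_cat tn /n; have [es|es] := leqP e (size s0); first by rewrite eS// subnKC.
  have -> : (size s0 - e = 0)%N by apply/eqP; rewrite subn_eq0 ltnW.
  by rewrite addn0 /u take_oversize// ltnW.
have be : bottom D (u ++ t) = e by rewrite /bottom sz.
have tk : take e (u ++ t) = u.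
  have [es|es] := leqP e (size s0); first by rewrite take_size_cat// eS.
  have t0 : t = [::] by apply: size0nil; rewrite tn /n; lia.
  by rewrite t0 cats0 /u take_oversize// size_take; case: ifP => //; lia.
have dr : all (fun v => v <= 2)%N (drop e (u ++ t)).
  have [es|es] := leqP e (size s0); first by rewrite drop_size_cat// eS.
  by rewrite drop_oversize// sz ltnW.
rewrite mem_filter /class_key be tk sz eqxx /= mem_filter mem_kunzs stK sumn_cat tg subnKC// eqxx.
rewrite andbT /free_tail sz be dr andbT.
case/and3P: s0D => -> s3 _ /=; rewrite all_cat (sub_all _ t2) ?andbT => [|v]; last exact: leqW.
by apply/allP => v /mem_take; exact: (allP s3).
Qed.

Lemma free_tail_num (eta : R) (D g m e n r su : nat) :
  m = (e + n).+1 -> g = (su + (n + r))%N -> (e <= su <= 3 * e)%N -> (e * D <= m)%N ->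
  0 < eta <= 1/10 -> 4 <= eta * D%:R ->
  (gamma R - eta) * g%:R < m%:R < (gamma R + eta) * g%:R ->
  [/\ e%:R <= eta / 4 * m%:R, 4/10 * g%:R - 1 <= n%:R :> R
    & `|r%:R - (1 - x) * n%:R| <= 3 * eta * g%:R + 2].
Proof.
move=> mE gE /andP[esu sue] eD /andP[eta0 eta1] etaD /andP[m1 m2].
have /andP[x0 x1] := @gold_bounds R.
have /andP[c0 c1] := @gamma_bounds R.
have eR := frac_le R eta D e m (ltW eta0) etaD eD.
have mR : m%:R = e%:R + n%:R + 1 :> R by rewrite mE -natr1 natrD.
have gR : g%:R = su%:R + n%:R + r%:R :> R by rewrite gE !natrD addrA.
have suR1 : e%:R <= su%:R :> R by rewrite ler_nat.
have suR2 : su%:R <= 3 * e%:R :> R by rewrite -natrM ler_nat.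
have g0 : 0 <= g%:R :> R by [].
have m0 : 0 <= m%:R :> R by [].
have e0 : 0 <= e%:R :> R by [].
have etag0 : 0 <= eta * g%:R by rewrite mulr_ge0// ltW.
have etag : eta * g%:R <= 1/10 * g%:R by rewrite ler_wpM2r.
have cg1 : 723/1000 * g%:R <= gamma R * g%:R by rewrite ler_wpM2r// ltW.
have cg2 : gamma R * g%:R <= 724/1000 * g%:R by rewrite ler_wpM2r// ltW.
rewrite mulrBl in m1; rewrite mulrDl in m2.
have em : eta * m%:R <= 1/10 * m%:R by rewrite ler_wpM2r.
have em2 : eta * m%:R <= eta * g%:R.
  by apply: ler_wpM2l; [exact: ltW|clear -m2 etag cg2 g0; lra].
have eR' : e%:R <= eta * m%:R / 4 by rewrite mulrAC.
split=> //.
  move: (gamma R * g%:R) (eta * g%:R) (eta * m%:R) cg1 cg2 m1 m2 em em2 etag eR' => cg eg em'.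
  clear -mR g0; move=> *; lra.
have xm1 : (m%:R - eta * g%:R) * (2 - x) <= (gamma R * g%:R) * (2 - x).
  by rewrite ler_wpM2r//; [clear -x1; lra|clear -m2; lra].
have xm2 : (gamma R * g%:R) * (2 - x) <= (m%:R + eta * g%:R) * (2 - x).
  by rewrite ler_wpM2r//; [clear -x1; lra|clear -m1; lra].
have cgE : (gamma R * g%:R) * (2 - x) = g%:R.
  by rewrite mulrAC gamma_gold mul1r.
rewrite cgE in xm1 xm2.
have a1 : eta * g%:R * (2 - x) <= eta * g%:R * (14/10).
  by rewrite ler_wpM2l//; clear -x0; lra.
have a2 : e%:R * (2 - x) <= e%:R * (14/10) by rewrite ler_wpM2l//; clear -x0; lra.
have a3 : 0 <= e%:R * (2 - x) by rewrite mulr_ge0//; clear -x1; lra.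
(* g - m (2 - x) is small because [m] is close to gamma * g and gamma * (2 - x) = 1; the rest is
   controlled by the short initial segment. *)
have -> : r%:R - (1 - x) * n%:R =
    g%:R - m%:R * (2 - x) + (e%:R * (2 - x) + (2 - x) - su%:R).
  by rewrite gR mR; ring.
rewrite mulrBl in xm1; rewrite mulrDl in xm2.
rewrite -[3 * eta * _]mulrA.
move: (m%:R * (2 - x)) (e%:R * (2 - x)) (eta * g%:R * (2 - x)) xm1 xm2 a1 a2 a3.
move: (eta * m%:R) eR' em2 => em' eR' em2; move: (eta * g%:R) etag0 em2 => eg etag0 em2.
move=> mx ex egx xm1 xm2 a1 a2 a3.
clear -x0 x1 etag0 em2 suR1 suR2 eR' e0 xm1 xm2 a1 a2 a3.
by rewrite ler_norml; apply/andP; split; lra.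
Qed.
End FreeTail.

(** * Reading membership off the tail *)

Section Events.
Context {R : realType}.

Lemma sgp_mid (D : nat) s i : (bottom D s + i < size s)%N ->
  sgp s ((size s).+1 + (bottom D s + i).+1)%N <-> (kz s (bottom D s + i).+1 <= 1)%N.
Proof.
move=> im; rewrite -{1}(mul1n (size s).+1) sgpE//.
by split=> [[]//|]; right.
Qed.

(** A quotient of at least 3 suffices as all coordinates are at most 3. With quotient 2 the residue
    exceeds [bottom D s], where coordinates are at most 2. *)
Lemma sgp_high (D : nat) (eta : R) g s n : kunz s -> free_tail D eta g s ->
  (2 * (size s).+1 + bottom D s < n)%N -> sgp s n.
Proof.
move=> sK /and3P[_ /(all_nthP 0%N) s3 /(all_nthP 0%N) s2] hn.
set m := (size s).+1 in hn; rewrite (divn_eq n m).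
have im : (n %% m < m)%N by rewrite ltn_mod.
apply/sgpE => //; have [i0|i0] := boolP (n %% m == 0)%N; [by left|right].
have q2 : (2 <= n %/ m)%N by rewrite leq_divRL// ltnW// (leq_ltn_trans _ hn)// leq_addr.
set i := (n %% m)%N in im i0 *.
have ip : (0 < i)%N by rewrite lt0n.
have is' : (i.-1 < size s)%N by rewrite prednK// -ltnS.
have [q3|q3] := leqP 3 (n %/ m); first by apply: leq_trans q3; exact: s3.
apply: leq_trans (q2); rewrite /kz.
have ei : (bottom D s < i)%N.
  have q2' : (n %/ m = 2)%N by apply/eqP; rewrite eqn_leq q2 -ltnS q3.
  by move: hn; rewrite {1}(divn_eq n m) q2' ltn_add2l.
have e : i.-1 = (bottom D s + (i.-1 - bottom D s))%N by lia.
rewrite e -nth_drop; apply: s2; rewrite size_drop; lia.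
Qed.

Definition event (C C' : {fset nat}) (s : seq nat) : bool :=
  `[< (forall n, n \in C -> sgp s n) /\ (forall n, n \in C' -> ~ sgp s n) >].

Lemma shift_index k e n : (k.+1 + e < n < 2 * k.+1)%N ->
  exists2 i, n = (k.+1 + (e + i).+1)%N & (i < k - e)%N.
Proof. by move=> hn; exists (n - k.+1 - e).-1; lia. Qed.

(** Integers below [m] are gaps and those above 2 m + e are elements, so only the middle range
    constrains the tail, one coordinate per integer: 1 for membership, 2 for absence. *)
Lemma event_tail (D : nat) (eta : R) g (C C' : {fset nat}) s :
  kunz s -> free_tail D eta g s ->
  let m := (size s).+1 in let e := bottom D s in
  (forall n, n \in C -> (m + e < n < 2 * m)%N \/ (2 * m + e < n)%N) ->
  (forall n, n \in C' -> (m + e < n < 2 * m)%N \/ (0 < n < m)%N) ->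
  event C C' s = tail_ok (fun i => (m + (e + i).+1)%N \in C)
                         (fun i => (m + (e + i).+1)%N \in C') (drop e s).
Proof.
move=> sK sD m e HC HC'; have /and3P[_ _ /(all_nthP 0%N) s2] := sD.
have [K1 _ _] := kunzP _ sK.
have val12 i : (i < size s - e)%N -> (0 < nth 0 (drop e s) i <= 2)%N.
  move=> ie; rewrite s2 ?size_drop// andbT nth_drop; apply: (K1 (e + i).+1).
  by rewrite /=; lia.
have mid i : (i < size s - e)%N -> sgp s (m + (e + i).+1)%N <-> nth 0 (drop e s) i = 1%N.
  move=> ie; have h : (e + i < size s)%N by lia.
  rewrite (sgp_mid D)// /kz /= -nth_drop.
  have := val12 i ie; rewrite -/e; case: (nth 0%N (drop e s) i) => [|[|v]] //= _.
have idx n : (m + e < n < 2 * m)%N -> _ := @shift_index (size s) e n.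
apply/asboolP/allP => [[H H'] i|H].
  rewrite mem_iota size_drop => /= ie; apply/andP; split; apply/implyP => hi.
    by apply/eqP/mid => //; exact: H.
  have := H' _ hi; rewrite mid// => h.
  by have := val12 i ie; case: (nth _ _ _) h => [|[|[|]]].
have {}H i : (i < size s - e)%N ->
    ((m + (e + i).+1)%N \in C -> nth 0 (drop e s) i = 1%N) /\
    ((m + (e + i).+1)%N \in C' -> nth 0 (drop e s) i = 2).
  move=> ie; have hi : i \in iota 0 (size (drop e s)) by rewrite mem_iota size_drop.
  have /andP[/implyP h /implyP h'] := H i hi.
  by split=> ?; apply/eqP; [apply: h|apply: h'].
split=> n nC.
  have [/idx[i nE ie]|hn] := HC _ nC; last exact: (sgp_high D eta g).
  by rewrite nE; apply/mid => //; have [h _] := H i ie; apply: h; rewrite -nE.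
have [/idx[i nE ie]|hn] := HC' _ nC; last exact: sgp_gap.
rewrite nE mid//; have [_ h] := H i ie; rewrite h//.
by rewrite -nE.
Qed.

Lemma count_shift (C : {fset nat}) m e n :
  count (fun i => (m + (e + i).+1)%N \in C) (iota 0 n) =
  count (fun c => (m + e < c < m + e + n.+1)%N) C.
Proof.
rewrite -!size_filter -(size_map (fun i => (m + (e + i).+1)%N)).
apply/perm_size/uniq_perm.
- by rewrite map_inj_uniq ?filter_uniq ?iota_uniq// => i j; lia.
- by rewrite filter_uniq ?fset_uniq.
move=> c; rewrite mem_filter; apply/mapP/andP => [[i]|[hc cC]].
  by rewrite mem_filter mem_iota => /andP[iC i_n] ->; split=> //; lia.
exists (c - m - e).-1; last lia.
rewrite mem_filter mem_iota; apply/andP; split; last lia.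
by have -> : (m + (e + (c - m - e).-1).+1)%N = c by lia.
Qed.
End Events.

Lemma sumn_le c s : all (fun v => v <= c)%N s -> (sumn s <= c * size s)%N.
Proof. by elim: s => //= v s IHs /andP[vc /IHs]; rewrite mulnS; exact: leq_add. Qed.

Section Final.
Context {R : realType}.
Local Notation x := (@gold R).

Lemma ratio_close (eta tau z : R) (g n r l : nat) :
  381/1000 <= z <= 1 -> 0 < tau -> tau <= 1/2 -> 30 * eta <= tau ->
  5 * (1 + (4 + 2 * l%:R) / tau) <= g%:R ->
  4/10 * g%:R - 1 <= n%:R :> R -> `|r%:R - z * n%:R| <= 3 * eta * g%:R + 2 ->
  [/\ (l <= n)%N, (l <= r)%N
    & forall i j, (i < l)%N -> (j <= l)%N ->
      `|(r - j)%:R - z * (n - i)%:R| <= tau * (n - i)%:R].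
Proof.
move=> /andP[z0 z1] t0 t1 et gl ng rz.
have g0 : 0 <= g%:R :> R by [].
have l0 : 0 <= l%:R :> R by [].
pose w := (4 + 2 * l%:R) / tau.
have wt : w * tau = 4 + 2 * l%:R by rewrite /w mulfVK// gt_eqF.
have w0 : 0 <= w by rewrite divr_ge0 ?(ltW t0)// addr_ge0// mulr_ge0.
have w1 : 2 * (4 + 2 * l%:R) <= w.
  by have := ler_wpM2l w0 t1; rewrite wt; clear; lra.
have gl' : 5 * (1 + w) <= g%:R by [].
have n2l : 2 * l%:R <= n%:R :> R by clear -ng gl' w1 l0; lra.
have tg : tau * (5 * (1 + w)) <= tau * g%:R by rewrite ler_wpM2l// ltW.
have tn : tau * (4/10 * g%:R - 1) <= tau * n%:R by rewrite ler_wpM2l// ltW.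
have eg : 30 * eta * g%:R <= tau * g%:R by rewrite ler_wpM2r.
(* As 30 eta <= tau, the drift 6 eta g is at most tau * g / 5. Of tau * n >= tau * (4/10 g - 1) at
   least tau * (g/5 - 1) >= 4 + 2 l is then left, which is the origin of the lower bound on [g]. *)
have key : 2 * (3 * eta * g%:R + 2 + l%:R) <= tau * n%:R.
  have -> : 2 * (3 * eta * g%:R + 2 + l%:R) = 30 * eta * g%:R / 5 + (4 + 2 * l%:R) by field.
  have -> : 4 + 2 * l%:R = tau * w by rewrite [tau * w]mulrC wt.
  have e1 : tau * (5 * (1 + w)) = 5 * tau + 5 * (tau * w) by ring.
  have e2 : tau * (4/10 * g%:R - 1) = 4/10 * (tau * g%:R) - tau by ring.
  rewrite e1 in tg; rewrite e2 in tn.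
  by move: (tau * w) (30 * eta * g%:R) (tau * g%:R) tg tn eg => a b c; clear -t0; lra.
have /andP[rz1 rz2] : - (3 * eta * g%:R + 2) <= r%:R - z * n%:R <= 3 * eta * g%:R + 2.
  by rewrite -ler_norml.
have n0 : 0 <= n%:R :> R by [].
have tn2 : tau * n%:R <= 1/2 * n%:R by rewrite ler_wpM2r.
have zn : 381/1000 * n%:R <= z * n%:R by rewrite ler_wpM2r.
have lr : l%:R <= r%:R :> R.
  by move: (3 * eta * g%:R) (z * n%:R) (tau * n%:R) key rz1 tn2 zn => a b c; clear -n0; lra.
have ln : (l <= n)%N by rewrite -(ler_nat R); clear -n2l l0; lra.
rewrite !ler_nat in lr; split=> // i j il jl.
have jr : (j <= r)%N by exact: leq_trans jl lr.
have in' : (i <= n)%N by rewrite (leq_trans (ltnW il)).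
rewrite !natrB//.
have -> : r%:R - j%:R - z * (n%:R - i%:R) = (r%:R - z * n%:R) + (z * i%:R - j%:R) by ring.
have iR : i%:R <= l%:R :> R by rewrite ler_nat ltnW.
have jR : j%:R <= l%:R :> R by rewrite ler_nat.
have i0 : 0 <= i%:R :> R by [].
have j0 : 0 <= j%:R :> R by [].
have zi : z * i%:R <= i%:R by rewrite ler_piMl.
have zi0 : 0 <= z * i%:R by rewrite mulr_ge0//; clear -z0; lra.
have h2 : `|z * i%:R - j%:R| <= l%:R.
  by rewrite ler_norml; clear -iR jR i0 j0 zi zi0; apply/andP; split; lra.
apply: (le_trans (ler_normD _ _)); apply: (le_trans (lerD rz h2)).
have h3 : tau * (n%:R / 2) <= tau * (n%:R - i%:R).
  by rewrite ler_wpM2l ?(ltW t0)//; clear -n2l iR; lra.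
apply: le_trans h3.
by move: key; rewrite mulrA; move: (tau * n%:R) (3 * eta * g%:R) => a b; clear; lra.
Qed.

(** Within one class the event prescribes [c1] tail entries as 1 and [c2] as 2, so its share is a
    quotient of two binomial coefficients, and [binom_ratio] applies with z = 1 - x, the limiting
    proportion of entries 2. *)
Lemma class_event_le (D : nat) (eta eps1 tau : R) (g l : nat) (C C' : {fset nat}) s0 :
  0 < eta <= 1/10 -> 4 <= eta * D%:R -> 8 * eta <= eps1 ->
  0 < tau -> tau <= 1/2 -> 30 * eta <= tau ->
  5 * (1 + (4 + 2 * l%:R) / tau) <= g%:R ->
  (forall n, n \in C -> admissible g eps1 n) ->
  (forall n, n \in C' -> admissible g eps1 n) ->
  (forall n, n \in C -> (gamma R - eps1) * g%:R <= n%:R) ->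
  (forall n, n \in C' -> n%:R <= (2 * gamma R + eps1) * g%:R) ->
  (C `&` C' = fset0)%fset ->
  (#|` C| + #|` C'| <= l)%N ->
  let mid (n : nat) := (gamma R < n%:R / g%:R < 2 * gamma R) in
  s0 \in kunzs g -> free_tail D eta g s0 ->
  `|\sum_(s <- [seq s <- kunzs g | free_tail D eta g s] | class_key D s == class_key D s0)
      ((event C C' s)%:R - x ^+ count mid C * (1 - x) ^+ count mid C')|
  <= l%:R * tau * (count (fun s => class_key D s == class_key D s0)
                    [seq s <- kunzs g | free_tail D eta g s])%:R.
Proof.
move=> eta01 etaD eta8 t0 t1 et gl admC admC' lowC highC' CC' Cl mid s0K s0D.
have /andP[eta0 eta1] := eta01.
have /andP[x0 x1] := @gold_bounds R.
have /andP[_ cg1] := @gamma_bounds R.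
have D0 : 0 < D%:R :> R.
  rewrite lt0r ler0n andbT; apply: contraTneq etaD => ->.
  by rewrite mulr0 -ltNge.
have D40 : 40 <= D%:R :> R.
  have h : eta * D%:R <= 1/10 * D%:R by rewrite ler_wpM2r// ltW.
  by have := le_trans etaD h; clear; lra.
have {}D40 : (40 <= D)%N by rewrite -(ler_nat R).
have g0 : 0 < g%:R :> R.
  apply: lt_le_trans gl; rewrite mulr_gt0// ltr_pwDl// divr_ge0 ?(ltW t0)//.
  by rewrite addr_ge0// mulr_ge0.
pose m := (size s0).+1; pose e := bottom D s0; pose n := (size s0 - e)%N.
pose u := take e s0; pose r := (sumn (drop e s0) - n)%N.
have eD : (e * D <= m)%N by rewrite /e /bottom leq_divM.
have es : (e <= size s0)%N.
  rewrite /e /bottom -ltnS; apply: ltn_Pdiv => //; exact: leq_trans D40.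
have mE : m = (e + n).+1 by rewrite /n subnKC.
have /andP[s0kz /eqP s0g] : kunz s0 && (sumn s0 == g) by rewrite -mem_kunzs.
have su : size u = e by rewrite size_takel.
have s01 : all (leq 1) s0 by case/and3P: s0kz.
have /and3P[mrange s03 _] := s0D.
have usum : (e <= sumn u <= 3 * e)%N.
  rewrite -su size_le_sumn /=; last by apply/allP => v /mem_take; exact: (allP s01).
  apply: sumn_le; apply/allP => v /mem_take; exact: (allP s03).
have nsum : (n <= sumn (drop e s0))%N.
  rewrite /n -size_drop size_le_sumn//.
  by apply/allP => v /mem_drop; exact: (allP s01).
have gE : g = (sumn u + (n + r))%N.
  by rewrite /r subnKC// -sumn_cat cat_take_drop.
have [eR nR rR] := free_tail_num eta D g m e n r (sumn u) mE gE usum eD eta01 etaD mrange.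
have z01 : 381/1000 <= 1 - x <= 1.
  by clear -x0 x1; apply/andP; split; lra.
have [ln lr close] := ratio_close eta tau (1 - x) g n r l z01 t0 t1 et gl nR rR.
have /andP[m1 m2] : (gamma R - eta) * g%:R < m%:R < (gamma R + eta) * g%:R := mrange.
have etag0 : 0 < eta * g%:R by rewrite mulr_gt0.
have epsg : 8 * (eta * g%:R) <= eps1 * g%:R by rewrite mulrA ler_wpM2r// ltW.
have eR' : e%:R <= eta * g%:R / 4.
  have cg : gamma R * g%:R <= 724/1000 * g%:R by rewrite ler_wpM2r// ltW.
  have eg : eta * g%:R <= 1/10 * g%:R by rewrite ler_wpM2r// ltW.
  apply: (le_trans eR); rewrite mulrAC ler_wpM2r ?invr_ge0//.
  apply: ler_wpM2l; first exact: ltW.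
  by rewrite mulrDl in m2; clear -m2 cg eg g0; lra.
rewrite mulrBl in m1; rewrite mulrDl in m2.
(* [m] is within eta * g of gamma * g, and [e] is at most eta * g / 4. As 8 eta <= eps1, the
   excluded neighbourhoods contain all places where the two conditions could differ. *)
have midE n' : admissible g eps1 n' -> mid n' = (m + e < n' < 2 * m)%N.
  rewrite /mid ltr_pdivlMr// ltr_pdivrMr// -!(ltr_nat R) natrD natrM => adm.
  move: adm; rewrite /admissible !mulrBl !mulrDl -mulrA => adm.
  move: (gamma R * g%:R) (eta * g%:R) (eps1 * g%:R) m1 m2 eR' epsg etag0 (ler0n R e) adm.
  clear => cg eg epsg m1 m2 eR' epsgg etag0 e0 [/andP[h1 h2]|[/andP[h1 h2]|/andP[h1 h2]]].
  - by apply/idP/idP => /andP[h3 h4]; apply/andP; split; lra.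
  - by apply/idP/idP => /andP[h3 h4]; apply/andP; split; lra.
  - by apply/idP/idP => /andP[h3 h4]; apply/andP; split; lra.
have HC n' : n' \in C -> (m + e < n' < 2 * m)%N \/ (2 * m + e < n')%N.
  move=> nC; rewrite -!(ltr_nat R) !natrD !natrM; have := admC _ nC; have := lowC _ nC.
  rewrite /admissible !mulrBl !mulrDl -mulrA.
  move: (gamma R * g%:R) (eta * g%:R) (eps1 * g%:R) m1 m2 eR' epsg etag0 (ler0n R e).
  clear => cg eg epsg m1 m2 eR' epsgg etag0 e0 low [/andP[h1 h2]|[/andP[h1 h2]|/andP[h1 h2]]].
  - by exfalso; lra.
  - by left; apply/andP; split; lra.
  - by right; lra.
have HC' n' : n' \in C' -> (m + e < n' < 2 * m)%N \/ (0 < n' < m)%N.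
  move=> nC; rewrite -!(ltr_nat R) !natrD !natrM; have := admC' _ nC; have := highC' _ nC.
  rewrite /admissible !mulrBl !mulrDl -mulrA.
  move: (gamma R * g%:R) (eta * g%:R) (eps1 * g%:R) m1 m2 eR' epsg etag0 (ler0n R e).
  clear => cg eg epsg m1 m2 eR' epsgg etag0 e0 high [/andP[h1 h2]|[/andP[h1 h2]|/andP[h1 h2]]].
  - by right; apply/andP; split; lra.
  - by left; apply/andP; split; lra.
  - by exfalso; lra.
pose p1 i := (m + (e + i).+1)%N \in C; pose p2 i := (m + (e + i).+1)%N \in C'.
have p12 i : p1 i -> ~~ p2 i.
  rewrite /p1 /p2 => h; apply/negP => h'.
  by have := in_fset0 (m + (e + i).+1)%N; rewrite -CC' inE h h'.
have m2E : (2 * m = m + e + n.+1)%N by rewrite mul2n -addnn -addnA addnS -mE.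
have count_mid (B : {fset nat}) : (forall n', n' \in B -> admissible g eps1 n') ->
    count mid B = count (fun i => (m + (e + i).+1)%N \in B) (iota 0 n).
  move=> admB; rewrite count_shift; apply: eq_in_count => n' /admB/midE ->.
  by rewrite m2E.
set c1 := count mid C; set c2 := count mid C'.
have c1E : c1 = count p1 (iota 0 n) by exact: count_mid.
have c2E : c2 = count p2 (iota 0 n) by exact: count_mid.
have c1C : (c1 <= #|` C|)%N by exact: count_size.
have c2C : (c2 <= #|` C'|)%N by exact: count_size.
have c12l : (c1 + c2 <= l)%N by apply: leq_trans Cl; exact: leq_add.
have c2r : (c2 <= r)%N by rewrite (leq_trans _ lr)// (leq_trans _ c12l)// leq_addl.
have perm := class_perm D eta g s0 s0K s0D.
rewrite -/e -/n -/u in perm.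
set X := [seq s <- kunzs g | free_tail D eta g s] in perm *.
set T := [seq t <- lists 2 n | _] in perm.
have gu : (g - sumn u = n + r)%N by rewrite gE addKn.
have sizeT : size T = 'C(n, r).
  have := tail_countE pred0 pred0 n r (fun _ _ => isT).
  rewrite !count_pred0 /= !subn0 add0n => -[_ _ <-].
  rewrite /T size_filter gu /tail_count; apply: eq_count => t /=.
  rewrite /tail_ok (_ : all _ _ = true) ?andbT//.
  by apply/allP.
have countT : count (fun t => event C C' (u ++ t)) T = 'C(n - c1 - c2, r - c2).
  have [_ _ H] := tail_countE p1 p2 n (r - c2) p12.
  rewrite -c1E -c2E in H; rewrite -H subnKC// /T count_filter gu /tail_count.
  have uT t : t \in T -> event C C' (u ++ t) = tail_ok p1 p2 t.
    move=> tT; have : u ++ t \in [seq u ++ t | t <- T] by exact: map_f.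
    rewrite -(perm_mem perm) mem_filter => /andP[/eqP[sz tk]].
    rewrite /X mem_filter mem_kunzs => /andP[sD /andP[sK _]].
    have be : bottom D (u ++ t) = e by rewrite /bottom sz.
    have := event_tail D eta g C C' (u ++ t) sK sD.
    by rewrite be sz => -> //; rewrite drop_size_cat.
  apply: eq_in_count => t tl /=; rewrite andbC.
  case: (boolP (sumn t == n + r)%N) => //= st.
  by apply: uT; rewrite mem_filter tl gu st.
have -> : count (fun s => class_key D s == class_key D s0) X = size T.
  by rewrite -size_filter (perm_size perm) size_map.
have -> : \sum_(s <- X | class_key D s == class_key D s0)
      ((event C C' s)%:R - x ^+ c1 * (1 - x) ^+ c2) =
    (count (fun t => event C C' (u ++ t)) T)%:R - x ^+ c1 * (1 - x) ^+ c2 * (size T)%:R :> R.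
  rewrite -big_filter (perm_big _ perm) big_map sumrB -natr_sum; congr (_%:R - _).
    by rewrite -sum1_count [RHS]big_mkcond; apply: eq_bigr => t _; case: (event _ _ _).
  by rewrite big_const_seq count_predT iter_addr_0 mulr_natr.
rewrite sizeT countT.
have [_] := binom_ratio R (1 - x) tau n r c1 c2 l ltac:(by case/andP: z01 => h1 h2; apply/andP; split => //; clear -h1; lra)
  (ltW t0) c12l ln c2r (fun i j hj hi => close i j hi (leq_trans hj (leq_trans (leq_addl c1 c2) c12l))).
have -> : 1 - (1 - x) = x by ring.
move=> /le_trans; apply.
by rewrite ler_wpM2r// ler_wpM2r ?(ltW t0)// ler_nat.
Qed.
End Final.

(** * From classes to the probability *)

Lemma prod_count (R : realFieldType) (P : pred nat) (f : nat -> R) (w : R) (C : {fset nat}) :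
  (forall n, n \in C -> f n = if P n then w else 1) ->
  \prod_(n <- C) f n = w ^+ count P C.
Proof.
move=> fE; rewrite big_seq (eq_bigr _ fE) -big_seq -big_mkcond.
by rewrite big_const_seq iter_mulr_1.
Qed.

Section F1.
Context {R : realType}.

Lemma f1_low (t : R) : t < gamma R -> f1 t = 0.
Proof. by rewrite /f1 => ->. Qed.

Lemma f1_mid (t : R) : gamma R < t < 2 * gamma R -> f1 t = gold.
Proof.
by move=> /andP[h1 h2]; rewrite /f1 ltNge (ltW h1)/= gt_eqF// h2.
Qed.

Lemma f1_high (t : R) : 2 * gamma R < t -> f1 t = 1.
Proof.
move=> h; have /andP[c0 _] := @gamma_bounds R.
have h1 : gamma R < t by apply: lt_trans h; clear -c0; lra.
by rewrite /f1 ltNge (ltW h1)/= gt_eqF// ltNge (ltW h)/= gt_eqF.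
Qed.
End F1.

Theorem theorem6p1 (R : realType) (l1 l2 : nat) (eps1 eps2 : R) :
  0 < eps1 -> 0 < eps2 ->
  exists M : R, 0 < M /\
    forall g : nat, M < g%:R ->
    forall C C' : {fset nat},
      (forall n, n \in C -> admissible g eps1 n) ->
      (forall n, n \in C' -> admissible g eps1 n) ->
      #|` C|%fset = l1 -> #|` C'|%fset = l2 -> (C `&` C' = fset0)%fset ->
      `| Pg R g [set S | (forall n, n \in C -> S n) /\ (forall n, n \in C' -> ~ S n)]
         - (\prod_(n <- C) f1 (n%:R / g%:R)) * (\prod_(n <- C') (1 - f1 (n%:R / g%:R))) |
      < eps2.
Proof.
move=> e10 e20; pose l := (l1 + l2)%N.
(* The error per prescribed entry, chosen so that all [l] of them together cost at most eps2 / 4;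
   [l.+1] keeps the denominator nonzero. *)
pose tau : R := Num.min (1/2) (eps2 / (4 * l.+1%:R)).
have t0 : 0 < tau by rewrite lt_min divr_gt0//= divr_gt0// mulr_gt0.
have t1 : tau <= 1/2 by rewrite ge_min lexx.
have lt : l%:R * tau <= eps2 / 4.
  apply: (@le_trans _ _ (l.+1%:R * (eps2 / (4 * l.+1%:R)))).
    by apply: ler_pM; rewrite ?ler_nat// ?(ltW t0)// ge_min lexx orbT.
  have L0 : l.+1%:R != 0 :> R by rewrite pnatr_eq0.
  by rewrite le_eqVlt; apply/orP; left; apply/eqP; move: (l.+1%:R) L0 => w w0; field.
pose eta : R := Num.min (1/10) (Num.min (eps1 / 8) (tau / 30)).
have eta0 : 0 < eta by rewrite !lt_min !divr_gt0.
have eta1 : eta <= 1/10 by rewrite ge_min lexx.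
have eta8 : 8 * eta <= eps1.
  by rewrite mulrC -ler_pdivlMr// !ge_min lexx orbT.
have et : 30 * eta <= tau.
  by rewrite mulrC -ler_pdivlMr// !ge_min lexx !orbT.
have eta01 : 0 < eta <= 1/10 by rewrite eta0.
have eta_1 : eta <= 1 by apply: (le_trans eta1); clear; lra.
have [D etaD] : exists D : nat, 4 <= eta * D%:R.
  exists (Num.bound (4 / eta)); rewrite mulrC -ler_pdivrMr//.
  by apply/ltW/archi_boundP; rewrite divr_ge0// ltW.
have D0 : (0 < D)%N.
  by rewrite lt0n; apply: contraTneq etaD => ->; rewrite mulr0 -ltNge.
have e4 : 0 < eps2 / 4 by rewrite divr_gt0.
have [M0 badM] := atypical_small D eta (eps2 / 4) eta0 eta_1 etaD e4.
exists (Num.max 1 (Num.max M0 (5 * (1 + (4 + 2 * l%:R) / tau)))).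
split; first by rewrite lt_max ltr01.
move=> g; rewrite !gt_max => /and3P[g1 gM0 gl] C C' admC admC' szC szC' CC'.
have g0 : 0 < g%:R :> R by apply: lt_trans g1.
have /andP[x0 x1] := @gold_bounds R.
have /andP[c0 c1] := @gamma_bounds R.
have N0 : 0 < (size (kunzs g))%:R :> R.
  rewrite lt0r ler0n andbT; apply: contraTneq (@size_kunzs_ge R g) => ->.
  by rewrite mul0r -ltNge; clear -x0; lra.
set K := kunzs g in N0 *; pose ev := event C C'.
rewrite [Pg _ _ _](_ : _ = (size [seq s <- K | ev s])%:R / (size K)%:R); last exact: Pg_kunzs.
set p := \prod_(n <- C) _ * \prod_(n <- C') _.
pose X := [seq s <- K | free_tail D eta g s].
have bad : (size [seq s <- K | ~~ free_tail D eta g s])%:R <= eps2 / 4 * (size K)%:R.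
  apply: le_trans (badM g gM0); rewrite ler_nat !size_filter; apply: sub_count => s.
  by apply: contra; exact: typical_free_tail.
have e1g : 0 < eps1 * g%:R by rewrite mulr_gt0.
have rhs0 : 0 <= eps2 / 4 * (size K)%:R by rewrite mulr_ge0// ltW.
have main : 0 <= p <= 1 /\
    `|\sum_(s <- X) ((ev s)%:R - p)| <= eps2 / 4 * (size K)%:R.
  (* A member of [C] below (gamma - eps1) g lies below every multiplicity occurring in [X]: it is
     always a gap, and its factor [f1] is 0, so both quantities vanish. *)
  have [lowC|nlowC] := pselect (forall n, n \in C -> (gamma R - eps1) * g%:R <= n%:R);
  last first.
    have [n0 /not_implyP[n0C /negP]] : exists n0, ~ (n0 \in C -> (gamma R - eps1) * g%:R <= n0%:R).
      exact/existsNP.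
    rewrite -ltNge => n0low.
    have p0 : p = 0.
      rewrite /p (bigD1_seq n0) ?fset_uniq//= f1_low ?mul0r//.
      by rewrite ltr_pdivrMr// (lt_trans n0low)// ltr_pM2r// gtrBl.
    rewrite p0 lexx ler01; split=> //.
    rewrite big_seq big1 ?normr0// => s.
    rewrite mem_filter mem_kunzs => /andP[/and3P[/andP[m1 _] _ _] /andP[sK _]].
    suff -> : ev s = false by rewrite subr0.
    apply/negP => /asboolP[/(_ _ n0C) + _]; apply: sgp_gap => //.
    apply/andP; split.
      rewrite -(ltr_nat R); have := admC _ n0C; rewrite /admissible.
      have cg : 0 <= gamma R * g%:R by rewrite mulr_ge0//; clear -c0; lra.
      move: n0low; rewrite !mulrBl !mulrDl -mulrA; clear -e1g cg.
      by move=> ? [/andP[]|[/andP[]|/andP[]]]; lra.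
    rewrite -(ltr_nat R) (lt_trans n0low)// (le_lt_trans _ m1)// ler_wpM2r//.
    by clear -eta8 eta0; lra.
  (* Dually, a member of [C'] above (2 gamma + eps1) g belongs to every semigroup coming from [X],
     and its factor 1 - f1 is 0. *)
  have [highC|nhighC] := pselect (forall n, n \in C' -> n%:R <= (2 * gamma R + eps1) * g%:R);
  last first.
    have [n0 /not_implyP[n0C /negP]] : exists n0, ~ (n0 \in C' -> n0%:R <= (2 * gamma R + eps1) * g%:R).
      exact/existsNP.
    rewrite -ltNge => n0high.
    have p0 : p = 0.
      rewrite /p [X in _ * X](bigD1_seq n0) ?fset_uniq//= f1_high ?subrr ?mul0r ?mulr0//.
      by rewrite ltr_pdivlMr// (lt_trans _ n0high)// ltr_pM2r// ltrDl.
    rewrite p0 lexx ler01; split=> //.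
    rewrite big_seq big1 ?normr0// => s.
    rewrite mem_filter mem_kunzs => /andP[sD /andP[sK _]].
    suff -> : ev s = false by rewrite subr0.
    apply/negP => /asboolP[_ /(_ _ n0C)]; apply.
    apply: (sgp_high D eta g) => //.
    have eR := frac_le R eta D (bottom D s) (size s).+1 (ltW eta0) etaD (leq_divM _ _).
    have /and3P[/andP[_ m2] _ _] := sD.
    rewrite -(ltr_nat R) natrD natrM; apply: le_lt_trans n0high.
    have h : eta / 4 * (size s).+1%:R <= 1/40 * (eta * 40 / 4 * (2 * g%:R)).
      have -> : 1/40 * (eta * 40 / 4 * (2 * g%:R)) = eta / 4 * (2 * g%:R) by field.
      rewrite ler_wpM2l ?divr_ge0 ?(ltW eta0)// (le_trans (ltW m2))// ler_wpM2r//.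
      by clear -c1 eta1; lra.
    have h8 : 8 * eta * g%:R <= eps1 * g%:R by rewrite ler_wpM2r.
    have eg0 : 0 <= eta * g%:R by rewrite mulr_ge0// ltW.
    have {}h : eta / 4 * (size s).+1%:R <= eta * g%:R.
      by apply: (le_trans h); clear -eg0; lra.
    have {}eR := le_trans eR h.
    rewrite !mulrDl -!mulrA in m2 h8 *.
    move: (gamma R * g%:R) (eta * g%:R) (eps1 * g%:R) m2 h8 eg0 eR => cg eg epg.
    by clear => *; lra.
  pose mid (n : nat) := (gamma R < n%:R / g%:R < 2 * gamma R).
  have cg0 : 0 <= gamma R * g%:R by rewrite mulr_ge0//; clear -c0; lra.
  have trich n : admissible g eps1 n -> [\/ n%:R < (gamma R - eps1) * g%:R, mid n
      | (2 * gamma R + eps1) * g%:R < n%:R].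
    move=> [/andP[_ h]|[/andP[h1 h2]|/andP[h _]]]; [by apply: Or31| |by apply: Or33].
    apply: Or32; rewrite /mid ltr_pdivlMr// ltr_pdivrMr//; apply/andP; split.
      by apply: le_lt_trans h1; rewrite ler_pM2r// lerDl ltW.
    by apply: lt_le_trans h2 _; rewrite ler_pM2r// gerBl ltW.
  have pE : p = gold ^+ count mid C * (1 - gold) ^+ count mid C'.
    rewrite /p; congr (_ * _); apply: prod_count => n nC.
      have [h|h|h] := trich n (admC n nC).
      - by have := lt_le_trans h (lowC n nC); rewrite ltxx.
      - by rewrite h f1_mid.
      - have h' : 2 * gamma R < n%:R / g%:R.
          by rewrite ltr_pdivlMr// (lt_trans _ h)// ltr_pM2r// ltrDl.
        by rewrite /mid [_ / _ < _]ltNge (ltW h') andbF f1_high.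
    have [h|h|h] := trich n (admC' n nC).
    - have h' : n%:R / g%:R < gamma R.
        by rewrite ltr_pdivrMr// (lt_trans h)// ltr_pM2r// gtrBl.
      by rewrite /mid ltNge (ltW h') f1_low// subr0.
    - by rewrite h f1_mid.
    - by have := lt_le_trans h (highC n nC); rewrite ltxx.
  split.
    have g1' : 0 <= 1 - @gold R by clear -x1; lra.
    have g2' : 1 - @gold R <= 1 by clear -x0; lra.
    have g3' : 0 <= @gold R by clear -x0; lra.
    have g4' : @gold R <= 1 by clear -x1; lra.
    by rewrite pE mulr_ge0 ?exprn_ge0// mulr_ile1 ?exprn_ge0 ?exprn_ile1.
  rewrite pE; apply: (@le_trans _ _ (l%:R * tau * (size X)%:R)).
    apply: (group_bound _ _ _ _ (class_key D)) => s0.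
    rewrite {1}/X mem_filter => /andP[s0D s0K].
    apply: (class_event_le D eta eps1 tau g l C C' s0) => //; first exact: ltW.
    by rewrite szC szC'.
  apply: ler_pM => //; first by rewrite mulr_ge0// ltW.
  by rewrite ler_nat size_filter count_size.
have [/andP[p0 p1] mainX] := main.
(* The lists outside [X] contribute at most 1 each in absolute value, hence another eps2 / 4 in
   proportion; the total eps2 / 2 leaves room for the strict inequality. *)
have sumK : (size [seq s <- K | ev s])%:R - p * (size K)%:R =
    \sum_(s <- X) ((ev s)%:R - p) +
    \sum_(s <- [seq s <- K | ~~ free_tail D eta g s]) ((ev s)%:R - p).
  rewrite /X !big_filter -[RHS](bigID (free_tail D eta g) xpredT) sumrB big_const_seq count_predT iter_addr_0 mulr_natr.
  congr (_ - _); rewrite size_filter -sum1_count natr_sum big_mkcond.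
  by apply: eq_bigr => s _; case: (ev s).
have badX : `|\sum_(s <- [seq s <- K | ~~ free_tail D eta g s]) ((ev s)%:R - p)|
    <= eps2 / 4 * (size K)%:R.
  apply: le_trans bad; apply: (le_trans (ler_norm_sum _ _ _)).
  rewrite -sum1_size natr_sum; apply: ler_sum => s _.
  rewrite ler_norml; case: (ev s) => /=; apply/andP; split; clear -p0 p1; lra.
have -> : (size [seq s <- K | ev s])%:R / (size K)%:R - p =
    ((size [seq s <- K | ev s])%:R - p * (size K)%:R) / (size K)%:R.
  by rewrite mulrBl mulfK// gt_eqF.
rewrite normrM normfV (gtr0_norm N0) ltr_pdivrMr// sumK.
apply: (le_lt_trans (ler_normD _ _)); apply: (le_lt_trans (lerD mainX badX)).
by rewrite -mulrDl ltr_pM2r//; clear -e20; lra.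
Qed.
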